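(* Let $k\geq 4$ be an even integer and let $\alpha\in(0,1]$. Suppose there is a polynomial-time $\alpha$-approximation algorithm for metric TSP. Then there is a polynomial-time $\alpha\cdot(1-0.5/k)\left(1-1/k+\frac{1}{k(k-1)}\right)$-approximation algorithm for metric $k$CP.
   Context: A metric graph is an undirected complete graph $G=(V,E)$ on $n$ vertices with a non-negative edge weight function $w$ satisfying the triangle inequality; for an edge set $Y$, $w(Y)=\sum_{e\in Y}w(e)$. Metric TSP here is the maximization problem: find a maximum weight Hamiltonian cycle; an $\alpha$-approximation algorithm for it outputs a Hamiltonian cycle of weight at least $\alpha$ times the maximum. A $k$-cycle is a simple cycle on exactly $k$ distinct vertices. When $k$ divides $n$, a $k$-cycle packing is a set of $n/k$ vertex-disjoint $k$-cycles covering all vertices. Metric $k$CP: given a metric graph with $n$ divisible by $k$, find a $k$-cycle packing of maximum total weight. A $\rho$-approximation algorithm outputs on every instance a feasible solution of weight at least $\rho$ times the optimum. *)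

(* Defs.v *)
From HB Require Import structures.
From Corelib Require Import BinNums.
From mathcomp Require Import all_boot all_order all_algebra.
From mathcomp Require Import reals.

Set Implicit Arguments.
Unset Strict Implicit.
Unset Printing Implicit Defensive.

Import Order.TTheory GRing.Theory Num.Theory.

(** * Model of computation

    The WHILE language of N. D. Jones (Computability and Complexity from a
    Programming Perspective, MIT Press, 1997): imperative programs over binary
    trees, in which [cons], [hd], [tl] and a test against [nil] each take one
    time unit.  Polynomial time in this model is polynomial time on Turing
    machines. *)

Inductive tree : Type :=
| Nil
| Cons of tree & tree.

Fixpoint tree_size (t : tree) : nat :=
  if t is Cons a b then (tree_size a + tree_size b).+1 else 1.

Definition tree_hd (t : tree) : tree := if t is Cons a _ then a else Nil.
Definition tree_tl (t : tree) : tree := if t is Cons _ b then b else Nil.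

Inductive expr : Type :=
| EVar of nat
| ENil
| ECons of expr & expr
| EHd of expr
| ETl of expr.

Inductive cmd : Type :=
| CAssign of nat & expr
| CSeq of cmd & cmd
| CIf of expr & cmd & cmd
| CWhile of expr & cmd.

Definition store := nat -> tree.

Definition update (s : store) (x : nat) (t : tree) : store :=
  fun y => if y == x then t else s y.

Fixpoint eval (s : store) (e : expr) : tree :=
  match e with
  | EVar x => s x
  | ENil => Nil
  | ECons a b => Cons (eval s a) (eval s b)
  | EHd a => tree_hd (eval s a)
  | ETl a => tree_tl (eval s a)
  end.

Fixpoint expr_cost (e : expr) : nat :=
  match e with
  | EVar _ | ENil => 1
  | ECons a b => (expr_cost a + expr_cost b).+1
  | EHd a | ETl a => (expr_cost a).+1
  end.

(* [exec c s t s'] : started in store [s], the command [c] halts after exactly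
   [t] time units in store [s'].  [Nil] is false, every other tree is true. *)
Inductive exec : cmd -> store -> nat -> store -> Prop :=
| ExecAssign x e s :
    exec (CAssign x e) s (expr_cost e).+1 (update s x (eval s e))
| ExecSeq c1 c2 s1 s2 s3 t1 t2 :
    exec c1 s1 t1 s2 -> exec c2 s2 t2 s3 ->
    exec (CSeq c1 c2) s1 (t1 + t2) s3
| ExecIfTrue e c1 c2 s s' t :
    eval s e <> Nil -> exec c1 s t s' ->
    exec (CIf e c1 c2) s ((expr_cost e).+1 + t) s'
| ExecIfFalse e c1 c2 s s' t :
    eval s e = Nil -> exec c2 s t s' ->
    exec (CIf e c1 c2) s ((expr_cost e).+1 + t) s'
| ExecWhileTrue e c s1 s2 s3 t1 t2 :
    eval s1 e <> Nil -> exec c s1 t1 s2 -> exec (CWhile e c) s2 t2 s3 ->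
    exec (CWhile e c) s1 ((expr_cost e).+1 + t1 + t2) s3
| ExecWhileFalse e c s :
    eval s e = Nil -> exec (CWhile e c) s (expr_cost e).+1 s.

(* Variable 0 holds the input and, at the end, the output; every other
   variable is initially [Nil]. *)
Definition init_store (a : tree) : store := update (fun=> Nil) 0 a.

Definition computes_in (c : cmd) (a b : tree) (t : nat) : Prop :=
  exists s : store, exec c (init_store a) t s /\ s 0 = b.

(** * Maximization problems and approximation algorithms *)

Record max_problem : Type := MaxProblem {
  instance : Type;
  solution : instance -> Type;
  valid : instance -> Prop;
  feasible : forall x : instance, solution x -> Prop;
  value : forall x : instance, solution x -> rat;
  enc_instance : instance -> tree;
  enc_solution : forall x : instance, solution x -> tree }.

Definition optimal (P : max_problem) (x : instance P) (y : solution x) : Prop :=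
  feasible y /\
  forall z : solution x, feasible z -> (value z <= value y)%R.

Definition polytime_approximable (R : realType) (P : max_problem) (rho : R)
    : Prop :=
  exists (c : cmd) (p : {poly nat}),
  forall x : instance P, valid x ->
  exists (y : solution x) (t : nat),
  [/\ computes_in c (enc_instance x) (enc_solution y) t,
      t <= p.[tree_size (enc_instance x)]%R,
      feasible y
    & forall opt : solution x, optimal opt ->
        (rho * ratr (value opt) <= ratr (value y))%R].

(** * Metric graphs, cycles and packings *)

(* The complete graph on the vertex set ['I_n], with rational edge weights.
   The edge {u, v} has weight [weight u v]; the diagonal carries no edge and
   is normalized to 0. *)
Record metric_graph : Type := MetricGraph {
  order_of : nat;
  weight : 'I_order_of -> 'I_order_of -> rat;
  weight_diag : forall u, weight u u = 0%R;
  weight_sym : forall u v, weight u v = weight v u;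
  weight_ge0 : forall u v, (0 <= weight u v)%R;
  weight_triangle : forall u v x, (weight u v <= weight u x + weight x v)%R }.

Notation vertex G := 'I_(order_of G).

(* A cycle is the sequence of its vertices in cyclic order; every such
   sequence of at least three distinct vertices is a cycle, as the graph is
   complete. *)
Definition is_kcycle (G : metric_graph) (k : nat) (c : seq (vertex G)) : bool :=
  [&& 2 < k, size c == k & uniq c].

Definition cycle_weight (G : metric_graph) (c : seq (vertex G)) : rat :=
  (\sum_(u <- c) weight u (next c u))%R.

Definition is_kcycle_packing (G : metric_graph) (k : nat)
    (C : seq (seq (vertex G))) : Prop :=
  [/\ size C = order_of G %/ k,
      all (is_kcycle k) C,
      uniq (flatten C)
    & forall v : vertex G, v \in flatten C].

Definition packing_weight (G : metric_graph) (C : seq (seq (vertex G))) : rat :=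
  (\sum_(c <- C) cycle_weight c)%R.

(** * Encodings

    Weights are written in binary.  Vertices are written in unary, which is
    polynomially equivalent to binary because the instance lists the whole
    n x n weight matrix. *)

Definition enc_seq (T : Type) (enc : T -> tree) (s : seq T) : tree :=
  foldr (fun x t => Cons (enc x) t) Nil s.

Definition enc_bool (b : bool) : tree := if b then Cons Nil Nil else Nil.

Fixpoint bits_of_pos (p : positive) : seq bool :=
  match p with
  | xH => [:: true]
  | xO q => false :: bits_of_pos q
  | xI q => true :: bits_of_pos q
  end.

(* Least significant bit first; 0 has no digit. *)
Definition bits_of_nat (n : nat) : seq bool :=
  if bin_of_nat n is Npos p then bits_of_pos p else [::].

Definition enc_bin (n : nat) : tree := enc_seq enc_bool (bits_of_nat n).

Definition enc_unary (n : nat) : tree := iter n (Cons Nil) Nil.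

(* Reduced fraction; the sign is dropped as only weights, which are
   non-negative, are encoded. *)
Definition enc_rat (q : rat) : tree :=
  Cons (enc_bin `|numq q|%N) (enc_bin `|denq q|%N).

Definition enc_graph (G : metric_graph) : tree :=
  enc_seq
    (fun u : vertex G =>
       enc_seq (fun v : vertex G => enc_rat (weight u v)) (enum 'I_(order_of G)))
    (enum 'I_(order_of G)).

Definition enc_vertex (G : metric_graph) (v : vertex G) : tree := enc_unary v.

Definition enc_cycle (G : metric_graph) (c : seq (vertex G)) : tree :=
  enc_seq (@enc_vertex G) c.

Definition enc_packing (G : metric_graph) (C : seq (seq (vertex G))) : tree :=
  enc_seq (@enc_cycle G) C.

(** * The two problems *)

(* A Hamiltonian cycle exists only on at least three vertices. *)
Definition metric_TSP : max_problem := {|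
  instance := metric_graph;
  solution := fun G => seq (vertex G);
  valid := fun G => 3 <= order_of G;
  feasible := fun G c => is_kcycle (order_of G) c;
  value := cycle_weight;
  enc_instance := enc_graph;
  enc_solution := enc_cycle |}.

Definition metric_kCP (k : nat) : max_problem := {|
  instance := metric_graph;
  solution := fun G => seq (seq (vertex G));
  valid := fun G => k %| order_of G;
  feasible := fun G C => is_kcycle_packing k C;
  value := packing_weight;
  enc_instance := enc_graph;
  enc_solution := enc_packing |}.

(* Main.v *)
(** Dropping the lightest edge of every cycle of a packing and joining the
    resulting paths greedily, each in the better of its two directions, gives a
    Hamiltonian cycle of at least [1 - 1/(2k)] times the weight: by the triangle
    inequality the links recover half of the dropped edges.

    Conversely, cut a Hamiltonian cycle into windows [v_1 .. v_k], in each of the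
    [k] possible ways, and close every window after reversing its part behind
    [v_i].  Weighting [i = k] (no reversal) by [k/2] and [i = 2, 4, .., k - 2] by
    1 each, the [k - 1] closed windows have average weight at least
    [w(P) + (w(odd edges) - w(even edges)) / (k - 1)]; summed over all windows,
    some cut and some [i] yield the factor [1 - 1/k + 1/(k(k - 1))].

    Only [k^2] packings are compared, and their weights are sums of binary
    fractions.  Polynomial time is obtained from a class of tree functions closed
    under composition, pairing, conditionals and folds with polynomially bounded
    accumulator. *)

From Stdlib Require Import FunctionalExtensionality.
From mathcomp Require Import all_boot all_order all_algebra.
From mathcomp Require Import reals.
From mathcomp Require Import zify ring lra.
Require Import Defs.

Set Implicit Arguments.
Unset Strict Implicit.
Unset Printing Implicit Defensive.

Import Order.TTheory GRing.Theory Num.Theory.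

(** * Polynomial-time functions on trees *)

(** Asking for a polynomial upper bound only lets running times be written as ordinary arithmetic;
    the polynomial itself comes from the closure lemmas. *)
Definition poly_bounded (F : nat -> nat) : Prop :=
  exists p : {poly nat}, forall n, F n <= p.[n]%R.

Lemma horner_nat_homo (p : {poly nat}) m n : m <= n -> p.[m]%R <= p.[n]%R.
Proof.
move=> le_mn; elim/poly_ind: p => [|p c IHp]; first by rewrite !horner0.
rewrite !hornerMXaddC.
exact: (leq_add (leq_mul IHp le_mn) (leqnn c)).
Qed.

Lemma poly_bounded_const c : poly_bounded (fun=> c).
Proof. by exists (c%:P)%R => n; rewrite hornerC. Qed.

Lemma poly_bounded_id : poly_bounded id.
Proof. by exists 'X%R => n; rewrite hornerX. Qed.

Lemma poly_bounded_horner (p : {poly nat}) : poly_bounded (fun n => p.[n]%R).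
Proof. by exists p. Qed.

Lemma poly_bounded_add F G :
  poly_bounded F -> poly_bounded G -> poly_bounded (fun n => F n + G n).
Proof.
by move=> [p Fp] [q Gq]; exists (p + q)%R => n; rewrite hornerD; apply: leq_add.
Qed.

Lemma poly_bounded_mul F G :
  poly_bounded F -> poly_bounded G -> poly_bounded (fun n => F n * G n).
Proof.
by move=> [p Fp] [q Gq]; exists (p * q)%R => n; rewrite hornerM; apply: leq_mul.
Qed.

Lemma poly_bounded_comp F G :
  poly_bounded F -> poly_bounded G -> poly_bounded (fun n => F (G n)).
Proof.
move=> [p Fp] [q Gq]; exists (p \Po q)%R => n; rewrite horner_comp.
exact: leq_trans (Fp _) (horner_nat_homo p (Gq n)).
Qed.

Ltac poly_bound :=
  repeat first
    [ exact: poly_bounded_const | exact: poly_bounded_id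
    | exact: poly_bounded_horner
    | match goal with |- poly_bounded (fun n => (?P).[@?G n]%R) =>
        refine (@poly_bounded_comp (fun n => P.[n]%R) G _ _) end
    | apply: poly_bounded_add | apply: poly_bounded_mul ].

(** The scratch variables below [m] are [Nil] before and after the run, and variables from [m] on
    have arbitrary content that survives. Programs can therefore be run one after another without
    renaming, and values can be saved at [m] or beyond. *)
Definition runs_within (c : cmd) (m : nat) (a b : tree) (t : nat) : Prop :=
  forall s : store, s 0 = a -> (forall y, 0 < y < m -> s y = Nil) ->
  exists2 t', exec c s t' (update s 0 b) & t' <= t.

(* The size of the output has to be bounded separately: iterating
   [x := cons x x] doubles [tree_size] in each time unit. *)
Definition polytime (f : tree -> tree) : Prop :=
  exists (c : cmd) (m : nat) (F : nat -> nat),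
  [/\ poly_bounded F,
      forall a, runs_within c m a (f a) (F (tree_size a))
    & forall a, tree_size (f a) <= F (tree_size a)].

(** An arbitrary bound [F] need not be monotone, but a polynomial over [nat] is; monotonicity is
    used whenever one bound is substituted into another. *)
Lemma polytime_horner f : polytime f ->
  exists (c : cmd) (m : nat) (p : {poly nat}),
    (forall a, runs_within c m a (f a) p.[tree_size a]%R)
  /\ (forall a, tree_size (f a) <= p.[tree_size a]%R).
Proof.
move=> [c [m [F [[p Fp] run sz]]]]; exists c, m, p; split=> a.
  by move=> s s0 cl; have [t et le_t] := run a s s0 cl; exists t => //; apply: leq_trans le_t (Fp _).
exact: leq_trans (sz a) (Fp _).
Qed.

Lemma exec_eq c s t s' t2 s2 : exec c s t s' -> t = t2 -> s' =1 s2 -> exec c s t2 s2.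
Proof. by move=> ex <- /functional_extensionality <-. Qed.

Lemma tree_size_gt0 a : 0 < tree_size a. Proof. by case: a. Qed.
Lemma tree_size_hd a : tree_size (tree_hd a) <= tree_size a.
Proof. by case: a => //= a b; lia. Qed.
Lemma tree_size_tl a : tree_size (tree_tl a) <= tree_size a.
Proof. by case: a => //= a b; lia. Qed.

Lemma polytime_const b : polytime (fun=> b).
Proof.
pose ex := fix ex b := if b is Cons x y then ECons (ex x) (ex y) else ENil.
exists (CAssign 0 (ex b)), 0, (fun=> (expr_cost (ex b)).+1 + tree_size b).
split; [by poly_bound| |by move=> a; lia].
move=> a s _ _; exists (expr_cost (ex b)).+1; last by lia.
apply: exec_eq (ExecAssign _ _ _) _ _ => // y; rewrite /update.
by case: eqP => // _; elim: b => //= x -> z ->.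
Qed.

Lemma polytime_id : polytime id.
Proof.
exists (CAssign 0 (EVar 0)), 0, (fun n => 2 + n).
split; [by poly_bound| |by move=> a; lia].
move=> a s s0 _; exists 2; last by lia.
by apply: exec_eq (ExecAssign _ _ _) _ _ => // y; rewrite /update /= s0.
Qed.

Lemma polytime_comp g f : polytime g -> polytime f -> polytime (fun a => g (f a)).
Proof.
move=> /polytime_horner[d [n [q [rung szg]]]] /polytime_horner[c [m [p [run sz]]]].
exists (CSeq c d), (maxn m n), (fun x => p.[x]%R + q.[p.[x]]%R).
split; first by poly_bound.
- move=> a s s0 cl.
  have [|t ex le_t] := run a s s0; first by move=> y ?; apply: cl; lia.
  have [||u ex' le_u] := rung (f a) (update s 0 (f a)).
  + by [].
  + by move=> y ?; rewrite /update ifN; [apply: cl; lia|lia].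
  exists (t + u).
    apply: exec_eq (ExecSeq ex ex') _ _ => // y; rewrite /update.
    by case: eqP.
  by have := horner_nat_homo q (sz a); lia.
- move=> a; have := szg (f a); have := horner_nat_homo q (sz a); lia.
Qed.

Lemma polytime_hd f : polytime f -> polytime (fun a => tree_hd (f a)).
Proof.
apply: polytime_comp; exists (CAssign 0 (EHd (EVar 0))), 0, (fun n => 3 + n).
split; [by poly_bound| |by move=> a; have := tree_size_hd a; lia].
move=> a s s0 _; exists 3; last by lia.
by apply: exec_eq (ExecAssign _ _ _) _ _ => // y; rewrite /update /= s0.
Qed.

Lemma polytime_tl f : polytime f -> polytime (fun a => tree_tl (f a)).
Proof.
apply: polytime_comp; exists (CAssign 0 (ETl (EVar 0))), 0, (fun n => 3 + n).
split; [by poly_bound| |by move=> a; have := tree_size_tl a; lia].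
move=> a s s0 _; exists 3; last by lia.
by apply: exec_eq (ExecAssign _ _ _) _ _ => // y; rewrite /update /= s0.
Qed.

Ltac store_cases :=
  rewrite /= /update /=; repeat (case: eqP => /= ?); try lia; try congruence.

(** The input is saved in variable [m] and the value of [f] in [m.+1], both above the scratch
    variables of the two programs; both are cleared at the end. *)
Lemma polytime_cons f g :
  polytime f -> polytime g -> polytime (fun a => Cons (f a) (g a)).
Proof.
move=> /polytime_horner[c [m1 [p [runf szf]]]] /polytime_horner[d [m2 [q [rung szg]]]].
pose m := (maxn m1 m2).+1.
exists (CSeq (CAssign m (EVar 0)) (CSeq c (CSeq (CAssign m.+1 (EVar 0))
  (CSeq (CAssign 0 (EVar m)) (CSeq d (CSeq (CAssign 0 (ECons (EVar m.+1) (EVar 0)))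
  (CSeq (CAssign m ENil) (CAssign m.+1 ENil)))))))), m.+2,
  (fun x => 20 + p.[x]%R + q.[x]%R).
split; [by poly_bound| |by move=> a /=; have := szf a; have := szg a; lia].
move=> a s s0 cl.
pose s1 := update s m (eval s (EVar 0)).
have s10 : s1 0 = a by rewrite /s1; store_cases.
have [|t ex le_t] := runf a s1 s10.
  by move=> y ?; rewrite /s1 /update ifN; [apply: cl|]; lia.
pose s2 := update s1 0 (f a).
pose s3 := update s2 m.+1 (eval s2 (EVar 0)).
pose s4 := update s3 0 (eval s3 (EVar m)).
have s40 : s4 0 = a by rewrite /s4 /s3 /s2 /s1; store_cases.
have [|u ex' le_u] := rung a s4 s40.
  move=> y ?; rewrite /s4 /s3 /s2 /s1 /update !ifN; [apply: cl| | | |]; lia.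
exists (2 + (t + (2 + (2 + (u + (4 + (2 + 2))))))); last by lia.
apply: exec_eq (ExecSeq (ExecAssign _ _ _) (ExecSeq ex (ExecSeq (ExecAssign _ _ _)
  (ExecSeq (ExecAssign _ _ _) (ExecSeq ex' (ExecSeq (ExecAssign _ _ _)
  (ExecSeq (ExecAssign _ _ _) (ExecAssign _ _ _)))))))) _ _ => // y.
have sm : s m = Nil by apply: cl; lia.
have sm1 : s m.+1 = Nil by apply: cl; lia.
by rewrite /s4 /s3 /s2 /s1; store_cases.
Qed.

Definition tif (c x y : tree) : tree := if c is Nil then y else x.

(** The value of the condition is first paired with the input, so the branching program only tests a
    head and both branches still find the input in the tail. *)
Lemma polytime_if f g h : polytime f -> polytime g -> polytime h ->
  polytime (fun a => tif (f a) (g a) (h a)).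
Proof.
move=> pf pg ph.
apply: (@polytime_comp (fun a => tif (tree_hd a) (g (tree_tl a)) (h (tree_tl a)))
                       (fun a => Cons (f a) a)); last first.
  exact: polytime_cons pf polytime_id.
have /polytime_horner[c [m1 [p [rung szg]]]] := polytime_comp pg (polytime_tl polytime_id).
have /polytime_horner[d [m2 [q [runh szh]]]] := polytime_comp ph (polytime_tl polytime_id).
exists (CIf (EHd (EVar 0)) c d), (maxn m1 m2), (fun x => 20 + p.[x]%R + q.[x]%R).
split; first by poly_bound.
- move=> a s s0 cl.
  have [|t ex le_t] := rung a s s0; first by move=> y ?; apply: cl; lia.
  have [|u ex' le_u] := runh a s s0; first by move=> y ?; apply: cl; lia.
  case ea: (tree_hd a) => [|x y] /=.
    by exists (3 + u); [apply: ExecIfFalse; rewrite /= ?s0|lia].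
  by exists (3 + t); [apply: ExecIfTrue; rewrite /= ?s0 ?ea|lia].
- by move=> a; have := szg a; have := szh a; case: (tree_hd a) => * /=; lia.
Qed.

(** * Lists as trees, and folds over lists *)

Fixpoint elems (t : tree) : seq tree := if t is Cons x u then x :: elems u else [::].
Definition tlist (s : seq tree) : tree := foldr Cons Nil s.

Lemma tlistK : cancel tlist elems.
Proof. by elim=> //= x s ->. Qed.

Lemma elemsK : cancel elems tlist.
Proof. by elim=> //= x _ u ->. Qed.

Lemma size_elems l : size (elems l) < tree_size l.
Proof. by elim: l => //= a _ b; lia. Qed.

Lemma tree_size_tlist_take i l : tree_size (tlist (take i (elems l))) <= tree_size l.
Proof. by elim: l i => [|a _ b IH] [|i] //=; have := IH i; lia. Qed.

(** The step is a function of one tree, so the current element, the accumulator and a constant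
    environment are packed together. *)
Definition tloop (step : tree -> tree) (l acc env : tree) : tree :=
  foldl (fun acc x => step (Cons x (Cons acc env))) acc (elems l).

(** The size hypothesis ranges over all lists, so it applies to every prefix of the actual list. It
    thus bounds all intermediate accumulators, on which the cost of the single steps depends. *)
Lemma polytime_loop_raw step (q : {poly nat}) : polytime step ->
  (forall l acc env, tree_size (tloop step l acc env)
       <= q.[tree_size l + tree_size acc + tree_size env]%R) ->
  polytime (fun a => tloop step (tree_hd a) (tree_hd (tree_tl a)) (tree_tl (tree_tl a))).
Proof.
move=> /polytime_horner[c [m0 [p [run sz]]]] bnd.
pose m := m0.+1.
pose body := CSeq (CAssign 0 (ECons (EHd (EVar m)) (ECons (EVar m.+1) (EVar m.+2))))
  (CSeq c (CSeq (CAssign m.+1 (EVar 0)) (CAssign m (ETl (EVar m))))).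
pose loop := CWhile (EVar m) body.
pose prog := CSeq (CAssign m (EHd (EVar 0))) (CSeq (CAssign m.+1 (EHd (ETl (EVar 0))))
  (CSeq (CAssign m.+2 (ETl (ETl (EVar 0)))) (CSeq loop (CSeq (CAssign 0 (EVar m.+1))
  (CSeq (CAssign m ENil) (CSeq (CAssign m.+1 ENil) (CAssign m.+2 ENil))))))).
(* The store at the loop head; [z] is whatever the previous iteration left in variable 0. *)
pose st s z l acc env := update (update (update (update s 0 z) m l) m.+1 acc) m.+2 env.
have loopP s env n B : (forall y, 0 < y < m -> s y = Nil) -> tree_size env <= n ->
    forall l acc z, tree_size l <= n ->
    (forall i, tree_size (foldl (fun acc x => step (Cons x (Cons acc env))) acc
       (take i (elems l))) <= B) ->
    exists2 t, exists z', exec loop (st s z l acc env) t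
                 (st s z' Nil (tloop step l acc env) env)
         & t <= tree_size l * (20 + p.[n + B + n + 2]%R).
  move=> cl envn; elim=> [|x _ l IH] acc z ln accB.
    exists 2; last by rewrite /=; lia.
    exists z; apply: ExecWhileFalse; rewrite /st; by store_cases.
  pose s1 := update (st s z (Cons x l) acc env) 0 (Cons x (Cons acc env)).
  have s10 : s1 0 = Cons x (Cons acc env) by [].
  have [|t ex le_t] := run _ s1 s10.
    move=> y ?; rewrite /s1 /st /update !ifN; [apply: cl| | | | |]; lia.
  have [||u [z' ex'] le_u] := IH (step (Cons x (Cons acc env))) (step (Cons x (Cons acc env))).
  - by move: ln => /=; lia.
  - by move=> i; have := accB i.+1.
  exists (2 + (7 + (t + (2 + 3))) + u).
    exists z'; apply: ExecWhileTrue ex'; first by rewrite /st; store_cases.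
    apply: exec_eq.
    - apply: ExecSeq (ExecAssign _ _ _) (ExecSeq _ (ExecSeq (ExecAssign _ _ _) (ExecAssign _ _ _))).
      apply: exec_eq (erefl) _; last by move=> y; reflexivity.
      suff -> : update (st s z (Cons x l) acc env) 0
        (eval (st s z (Cons x l) acc env)
          (ECons (EHd (EVar m)) (ECons (EVar m.+1) (EVar m.+2)))) = s1 by exact: ex.
      rewrite /s1; congr update; rewrite /st; by store_cases.
    - by [].
    - by move=> y; rewrite /s1 /st; store_cases.
  have : p.[tree_size (Cons x (Cons acc env))]%R <= p.[n + B + n + 2]%R.
    apply: horner_nat_homo; have := accB 0; rewrite take0.
    by move: ln => /=; lia.
  by move: le_t le_u => /=; lia.
exists prog, m.+3, (fun n => 40 + n * (20 + p.[n + q.[n + n + n]%R + n + 2]%R)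
                      + q.[n + n + n]%R).
split; first by poly_bound.
- move=> a s s0 cl; set n := tree_size a.
  have ln : tree_size (tree_hd a) <= n := tree_size_hd a.
  have an : tree_size (tree_hd (tree_tl a)) <= n.
    exact: leq_trans (tree_size_hd _) (tree_size_tl a).
  have en : tree_size (tree_tl (tree_tl a)) <= n.
    exact: leq_trans (tree_size_tl _) (tree_size_tl a).
  have cl' y : 0 < y < m -> s y = Nil by move=> ?; apply: cl; lia.
  have [|t [z ex] le_t] := loopP s (tree_tl (tree_tl a)) n (q.[n + n + n]%R)
     cl' en (tree_hd a) (tree_hd (tree_tl a)) a ln.
    move=> i; have := bnd (tlist (take i (elems (tree_hd a))))
      (tree_hd (tree_tl a)) (tree_tl (tree_tl a)).
    rewrite /tloop tlistK => /leq_trans; apply; apply: horner_nat_homo.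
    by have := tree_size_tlist_take i (tree_hd a); lia.
  exists (3 + (4 + (4 + (t + (2 + (2 + (2 + 2))))))); last first.
    move: le_t; have := leq_mul ln (leqnn (20 + p.[n + q.[n + n + n]%R + n + 2]%R)).
    by lia.
  have sm : s m = Nil by apply: cl; lia.
  have sm1 : s m.+1 = Nil by apply: cl; lia.
  have sm2 : s m.+2 = Nil by apply: cl; lia.
  apply: exec_eq.
  - apply: ExecSeq (ExecAssign _ _ _) (ExecSeq (ExecAssign _ _ _) (ExecSeq (ExecAssign _ _ _)
      (ExecSeq _ (ExecSeq (ExecAssign _ _ _) (ExecSeq (ExecAssign _ _ _)
      (ExecSeq (ExecAssign _ _ _) (ExecAssign _ _ _))))))).
    set s3 := update _ m.+2 _.
    suff -> : s3 = st s a (tree_hd a) (tree_hd (tree_tl a)) (tree_tl (tree_tl a)) by exact: ex.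
    apply: functional_extensionality => y; rewrite /s3 /st; by store_cases.
  - by [].
  - by move=> y; rewrite /st; store_cases.
- move=> a; set n := tree_size a.
  have := bnd (tree_hd a) (tree_hd (tree_tl a)) (tree_tl (tree_tl a)).
  have ln : tree_size (tree_hd a) <= n := tree_size_hd a.
  have an : tree_size (tree_hd (tree_tl a)) <= n.
    exact: leq_trans (tree_size_hd _) (tree_size_tl a).
  have en : tree_size (tree_tl (tree_tl a)) <= n.
    exact: leq_trans (tree_size_tl _) (tree_size_tl a).
  move=> /leq_trans; apply.
  suff : q.[tree_size (tree_hd a) + tree_size (tree_hd (tree_tl a)) +
            tree_size (tree_tl (tree_tl a))]%R <= q.[n + n + n]%R by lia.
  by apply: horner_nat_homo; lia.
Qed.

(** A step may multiply the tree size by a constant and yet raise a comparable potential [mu] only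
    additively. The increments of [mu] then add up to a polynomial, and [mu] dominates the size. *)
Lemma polytime_loop step (mu : tree -> nat) K fl facc fenv :
    polytime step ->
    (forall t, tree_size t <= mu t <= K * tree_size t) ->
    (forall x acc env, mu (step (Cons x (Cons acc env)))
        <= mu acc + K * (tree_size x + tree_size env)) ->
    polytime fl -> polytime facc -> polytime fenv ->
  polytime (fun a => tloop step (fl a) (facc a) (fenv a)).
Proof.
move=> pstep mu_bd mu_step pl pacc penv.
have bnd l acc env :
    mu (tloop step l acc env) <= mu acc + K * (tree_size l + tree_size l * tree_size env).
  rewrite /tloop; elim: l acc => [|x _ l IH] acc /=; first by lia.
  apply: leq_trans (IH _) _; have := mu_step x acc env; nia.
pose F n := K * n + K * (n + n * n).
have [q Fq] : poly_bounded F by rewrite /F; poly_bound.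
have praw : polytime (fun a => tloop step (tree_hd a) (tree_hd (tree_tl a))
                                    (tree_tl (tree_tl a))).
  apply: (polytime_loop_raw (q := q)) pstep _ => l acc env.
  set n := (_ + _ + _)%R; apply: leq_trans (Fq n); rewrite /F.
  have /andP[szmu _] := mu_bd (tloop step l acc env).
  have /andP[_ accmu] := mu_bd acc.
  apply: leq_trans szmu (leq_trans (bnd _ _ _) _).
  apply: leq_add; first by apply: leq_trans accmu _; rewrite leq_mul2l /n; lia.
  by rewrite leq_mul2l leq_add ?leq_mul ?orbT // /n; lia.
apply: (polytime_comp (f := fun a => Cons (fl a) (Cons (facc a) (fenv a))) praw).
by apply: polytime_cons pl _; apply: polytime_cons.
Qed.

Lemma polytime_loop_additive step K fl facc fenv :
    polytime step ->
    (forall x acc env, tree_size (step (Cons x (Cons acc env)))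
        <= tree_size acc + K * (tree_size x + tree_size env)) ->
    polytime fl -> polytime facc -> polytime fenv ->
  polytime (fun a => tloop step (fl a) (facc a) (fenv a)).
Proof.
move=> pstep add; apply: (polytime_loop (mu := tree_size) (K := K.+1) pstep).
  by move=> t; nia.
by move=> x acc env; have := add x acc env; nia.
Qed.

Ltac polytime_tac := repeat first
  [ exact: polytime_id | exact: polytime_const | assumption
  | apply: polytime_cons | apply: polytime_hd | apply: polytime_tl
  | apply: polytime_if ].

Definition trev (l : tree) : tree :=
  tloop (fun z => Cons (tree_hd z) (tree_hd (tree_tl z))) l Nil Nil.

Lemma trevE l : trev l = tlist (rev (elems l)).
Proof.
rewrite /trev /tloop /= -[RHS]/(tlist (catrev (elems l) [::])).
rewrite -[Nil]/(tlist [::]); elim: (elems l) [::] => //= x s IH r.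
by rewrite -[Cons x _]/(tlist (x :: r)) IH.
Qed.

Lemma elems_trev l : elems (trev l) = rev (elems l).
Proof. by rewrite trevE tlistK. Qed.

Lemma polytime_rev f : polytime f -> polytime (fun a => trev (f a)).
Proof.
move=> pf; apply: (polytime_loop_additive (K := 1)); polytime_tac.
by move=> x acc env /=; have := tree_size_gt0 env; lia.
Qed.

(* The index is the length of the list [u]; the unary code of a number
   is such a list. *)
Definition tnth (l u : tree) : tree :=
  tree_hd (tloop (fun z => tree_tl (tree_hd (tree_tl z))) u l Nil).

Lemma tnthE l u : tnth l u = nth Nil (elems l) (size (elems u)).
Proof.
rewrite /tnth /tloop; elim: (elems u) l => [|x s IH] [|a b] //=.
by rewrite IH nth_nil.
Qed.

Lemma polytime_nth f g : polytime f -> polytime g -> polytime (fun a => tnth (f a) (g a)).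
Proof.
move=> pf pg; apply: polytime_hd; apply: (polytime_loop_additive (K := 1)); polytime_tac.
by move=> x acc env /=; have := tree_size_tl acc; lia.
Qed.

(** * Binary arithmetic *)

(** Any tree other than [Nil] is accepted as the digit 1, so every tree denotes a binary number,
    lowest digit first. *)
Definition truthy (t : tree) : bool := if t is Nil then false else true.

Fixpoint bits_val (s : seq tree) : nat :=
  if s is x :: s' then truthy x + (bits_val s').*2 else 0.

Definition tval (t : tree) : nat := bits_val (elems t).

Definition bit_len (t : tree) : nat := size (elems t).

Lemma bits_val_rcons s x : bits_val (rcons s x) = bits_val s + 2 ^ size s * truthy x.
Proof. by elim: s => /= [|y s ->]; rewrite ?expnS; lia. Qed.

Lemma tval_enc_bin n : tval (enc_bin n) = n.
Proof.
rewrite /tval /enc_bin.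
have -> s : elems (enc_seq enc_bool s) = map enc_bool s by elim: s => //= b s ->.
rewrite /bits_of_nat -[RHS]bin_of_natK; case: bin_of_nat => //= p.
by elim: p => //= p IH; rewrite IH NatTrec.doubleE /=; lia.
Qed.

(** The shorter number is padded at its high end by [Nil], the digit 0, which changes neither
    value. *)
Fixpoint zip_pad (A B : seq tree) : seq tree :=
  if A is x :: A' then Cons x (head Nil B) :: zip_pad A' (behead B)
  else map (Cons Nil) B.

(** The accumulator consists of the unread part of [b] and the reversed list of pairs. If [b] is
    longer, its unread part is paired by the second loop, in [tzip]. *)
Definition tzip_head (a b : tree) : tree :=
  tloop (fun z => Cons (tree_tl (tree_hd (tree_hd (tree_tl z))))
      (Cons (Cons (tree_hd z) (tree_hd (tree_hd (tree_hd (tree_tl z)))))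
            (tree_tl (tree_hd (tree_tl z))))) a (Cons b Nil) Nil.

Definition tzip (a b : tree) : tree :=
  trev (tloop (fun z => Cons (Cons Nil (tree_hd z)) (tree_hd (tree_tl z)))
          (tree_hd (tzip_head a b)) (tree_tl (tzip_head a b)) Nil).

Lemma elems_tzip a b : elems (tzip a b) = zip_pad (elems a) (elems b).
Proof.
rewrite /tzip elems_trev -[RHS]revK; congr rev.
rewrite /tzip_head /tloop /=; set f := fun acc x => Cons (tree_tl _) _.
set g := fun acc x => Cons (Cons Nil x) acc.
suff zipP A c out : let r := foldl f (Cons c out) A in
    elems (foldl g (tree_tl r) (elems (tree_hd r))) = rev (zip_pad A (elems c)) ++ elems out.
  by rewrite zipP cats0.
elim: A c out => [|x A IH] c out /=; last first.
  by rewrite IH rev_cons cat_rcons /=; case: c.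
by elim: (elems c) out => //= y B IHB out; rewrite IHB /= rev_cons cat_rcons.
Qed.

Lemma polytime_zip f g : polytime f -> polytime g -> polytime (fun a => tzip (f a) (g a)).
Proof.
move=> pf pg; apply: polytime_rev.
have pr : polytime (fun a => tzip_head (f a) (g a)).
  apply: (polytime_loop_additive (K := 5)); polytime_tac.
  move=> x [|b c] env /=; have := tree_size_gt0 x; have := tree_size_gt0 env; first by lia.
  by case: b => [|b1 b2] /=; lia.
apply: (polytime_loop_additive (K := 5)); polytime_tac.
by move=> x acc env /=; have := tree_size_gt0 x; lia.
Qed.

Lemma size_zip_pad A B : size (zip_pad A B) = maxn (size A) (size B).
Proof. by elim: A B => [|x A IH] [|y B] //=; rewrite ?size_map ?IH /=; lia. Qed.

Lemma bits_val_zip_padl A B : bits_val (map tree_hd (zip_pad A B)) = bits_val A.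
Proof.
elim: A B => [|x A IH] B /=; last by rewrite IH.
by rewrite -map_comp; elim: B => //= y B ->.
Qed.

Lemma bits_val_zip_padr A B : bits_val (map tree_tl (zip_pad A B)) = bits_val B.
Proof.
elim: A B => [|x A IH] B /=; last by rewrite IH; case: B.
by rewrite -map_comp; elim: B => //= y B ->.
Qed.

Definition ttrue := Cons Nil Nil.

(** A full adder: the head of [z] is a pair of digits, and the accumulator is the carry followed by
    the digits of the sum found so far, highest first. *)
Definition tadd_step (z : tree) : tree :=
  let p := tree_hd (tree_hd z) in let q := tree_tl (tree_hd z) in
  let c := tree_hd (tree_hd (tree_tl z)) in
  Cons (tif p (tif q ttrue (tif c ttrue Nil)) (tif q (tif c ttrue Nil) Nil))
    (Cons (tif p (tif q (tif c ttrue Nil) (tif c Nil ttrue))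
                 (tif q (tif c Nil ttrue) (tif c ttrue Nil)))
          (tree_tl (tree_hd (tree_tl z)))).

Lemma tadd_stepE x c out env :
  let p := truthy (tree_hd x) in let q := truthy (tree_tl x) in
  tadd_step (Cons x (Cons (Cons c out) env)) =
  Cons (enc_bool (1 < p + q + truthy c)) (Cons (enc_bool (odd (p + q + truthy c))) out).
Proof. by rewrite /tadd_step /=; case: (tree_hd x); case: (tree_tl x); case: c. Qed.

Lemma polytime_add_step : polytime tadd_step.
Proof. by rewrite /tadd_step; polytime_tac. Qed.

(* The final accumulator [Cons carry out], read as a list, is the reversed sum. *)
Definition tadd (a b : tree) : tree :=
  trev (tloop tadd_step (tzip a b) (Cons Nil Nil) Nil).

Lemma polytime_add f g : polytime f -> polytime g -> polytime (fun a => tadd (f a) (g a)).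
Proof.
move=> pf pg; apply: polytime_rev; apply: (polytime_loop_additive (K := 5)).
- exact: polytime_add_step.
- move=> x acc env; have := tree_size_gt0 x; have := tree_size_gt0 env.
  case: acc => [|c out]; rewrite ?tadd_stepE /tadd_step /=;
    case: (tree_hd x); case: (tree_tl x) => //=; try case: c => *; rewrite /=; lia.
- exact: polytime_zip.
- by polytime_tac.
- by polytime_tac.
Qed.

Lemma truthy_enc_bool b : truthy (enc_bool b) = b. Proof. by case: b. Qed.

(** After reversal the carry is the top digit of the accumulator, so length, value and digit size
    can all be followed on the accumulator as a whole. *)
Lemma tadd_loopE Z c out :
  let r := foldl (fun acc x => tadd_step (Cons x (Cons acc Nil))) (Cons c out) Z in
  [/\ size (elems r) = size Z + (size (elems out)).+1,
      bits_val (rev (elems r)) = bits_val (rev (elems out)) + 2 ^ size (elems out) *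
        (truthy c + bits_val (map tree_hd Z) + bits_val (map tree_tl Z))
    & all (fun x => tree_size x <= 3) (elems (Cons c out)) ->
      all (fun x => tree_size x <= 3) (elems r)].
Proof.
elim: Z c out => [|x Z IH] c out /=.
  by split=> //; rewrite rev_cons bits_val_rcons size_rev; lia.
rewrite tadd_stepE.
case: (IH (enc_bool (1 < truthy (tree_hd x) + truthy (tree_tl x) + truthy c))
  (Cons (enc_bool (odd (truthy (tree_hd x) + truthy (tree_tl x) + truthy c))) out)).
move=> /= -> -> bits; split; first by lia.
  rewrite rev_cons bits_val_rcons size_rev !truthy_enc_bool expnS.
  by case: (truthy (tree_hd x)); case: (truthy (tree_tl x)); case: (truthy c) => /=; lia.
by move=> /andP[_ al]; apply: bits; rewrite al andbT; case: (1 < _); case: (odd _).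
Qed.

Lemma tval_add a b : tval (tadd a b) = tval a + tval b.
Proof.
rewrite /tval /tadd elems_trev /tloop; case: (tadd_loopE (elems (tzip a b)) Nil Nil) => _ -> _ /=.
by rewrite elems_tzip bits_val_zip_padl bits_val_zip_padr; lia.
Qed.

Lemma bit_len_add a b : bit_len (tadd a b) = (maxn (bit_len a) (bit_len b)).+1.
Proof.
rewrite /bit_len /tadd elems_trev size_rev /tloop.
by case: (tadd_loopE (elems (tzip a b)) Nil Nil) => -> _ _ /=; rewrite elems_tzip size_zip_pad addn1.
Qed.

(** Sums have normalized digits, of size at most 3. Their tree size is therefore controlled by the
    number of digits, whatever digits the summands had. *)
Lemma tree_size_bits t : all (fun x => tree_size x <= 3) (elems t) ->
  tree_size t <= 4 * bit_len t + 1.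
Proof.
rewrite /bit_len; elim: t => //= x _ u IH /andP[x3 /IH].
by lia.
Qed.

Lemma tadd_bits a b : all (fun x => tree_size x <= 3) (elems (tadd a b)).
Proof.
rewrite /tadd elems_trev all_rev /tloop.
by case: (tadd_loopE (elems (tzip a b)) Nil Nil) => _ _ ->.
Qed.

Lemma bit_len_size t : 2 * bit_len t + 1 <= tree_size t.
Proof.
by rewrite /bit_len; elim: t => //= x _ u IH; have := tree_size_gt0 x; lia.
Qed.

(** Digits come lowest first: a position where they differ overrides the verdict so far, and equal
    digits keep it. The initial verdict is true, for equal numbers. *)
Definition tle_step (z : tree) : tree :=
  let p := tree_hd (tree_hd z) in let q := tree_tl (tree_hd z) in
  let r := tree_hd (tree_tl z) in tif p (tif q r Nil) (tif q ttrue r).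

Definition tle (a b : tree) : tree := tloop tle_step (tzip a b) ttrue Nil.

Lemma truthy_tle a b : truthy (tle a b) = (tval a <= tval b).
Proof.
rewrite /tval -(bits_val_zip_padl (elems a) (elems b)) -(bits_val_zip_padr (elems a) (elems b)).
rewrite -elems_tzip -ltnS -[X in _ = (_ < X)]addn1 /tle /tloop.
(* The verdict on the lower digits enters as a unit added on the right: it turns a strict comparison
   of the remaining digits into a weak one. *)
suff leP Z r : truthy (foldl (fun acc x => tle_step (Cons x (Cons acc Nil))) r Z) =
    (bits_val (map tree_hd Z) < bits_val (map tree_tl Z) + truthy r) by exact: leP.
elim: Z r => [|x Z IH] r /=; first by case: r.
rewrite IH /tle_step /=; case: (tree_hd x) => [|??]; case: (tree_tl x) => [|??] /=;
  case: (truthy r) => /=; lia.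
Qed.

Lemma polytime_le f g : polytime f -> polytime g -> polytime (fun a => tle (f a) (g a)).
Proof.
move=> pf pg; apply: (polytime_loop_additive (K := 5)).
- by rewrite /tle_step; polytime_tac.
- move=> x acc env; have := tree_size_gt0 x; have := tree_size_gt0 acc; rewrite /tle_step /=.
  case: (tree_hd x) => [|??]; case: (tree_tl x) => [|??] /=; lia.
- exact: polytime_zip.
- by polytime_tac.
- by polytime_tac.
Qed.

(** Horner's rule from the highest digit: [Cons Nil] doubles the accumulator, and the multiplicand
    in the environment is added when the digit is 1. *)
Definition tmul_step (z : tree) : tree :=
  let acc := Cons Nil (tree_hd (tree_tl z)) in
  tif (tree_hd z) (tadd acc (tree_tl (tree_tl z))) acc.

Definition tmul (y x : tree) : tree := tloop tmul_step (trev x) Nil y.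

(** An addition rewrites all digits of the accumulator and may enlarge its tree by a constant
    factor, but the number of digits grows additively. The potential is the larger of the tree size
    and the size that normalized digits can take. *)
Lemma polytime_mul f g : polytime f -> polytime g -> polytime (fun a => tmul (f a) (g a)).
Proof.
move=> pf pg.
apply: (polytime_loop (mu := fun t => maxn (tree_size t) (4 * bit_len t + 1)) (K := 8)).
- apply: polytime_if; first by polytime_tac.
    by apply: polytime_add; polytime_tac.
  by polytime_tac.
- by move=> t; have := bit_len_size t; lia.
- move=> x acc env; rewrite /tmul_step /=.
  have := bit_len_size env; have := tree_size_gt0 x.
  case: x => [|x1 x2] /= _; first by rewrite /bit_len /=; lia.
  have := tree_size_bits (tadd_bits (Cons Nil acc) env).
  by rewrite bit_len_add /bit_len /=; lia.
- exact: polytime_rev.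
- by polytime_tac.
- by [].
Qed.

Lemma tval_mul y x : tval (tmul y x) = tval y * tval x.
Proof.
rewrite /tmul /tloop elems_trev {3}/tval foldl_rev.
elim: (elems x) => [|b s IH] //=; first by rewrite muln0.
rewrite /tmul_step /=; set acc := foldr _ _ _ in IH *.
have acc2 : tval (Cons Nil acc) = (tval acc).*2 by [].
by case: b => [|??]; rewrite /= ?tval_add ?acc2 IH /=; lia.
Qed.

Lemma bit_len_mul y x : bit_len (tmul y x) <= bit_len y + 2 * bit_len x.
Proof.
rewrite /tmul /tloop elems_trev {3}/bit_len foldl_rev.
elim: (elems x) => [|b s IH] //=.
rewrite /tmul_step /=; set acc := foldr _ _ _ in IH *.
have acc2 : bit_len (Cons Nil acc) = (bit_len acc).+1 by [].
by case: b => [|??]; rewrite /= ?bit_len_add ?acc2; lia.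
Qed.

Lemma tmul_bits y x : all (fun x => tree_size x <= 3) (elems (tmul y x)).
Proof.
rewrite /tmul /tloop elems_trev foldl_rev.
by elim: (elems x) => [|[|??] s IH] //=; rewrite /tmul_step /= tadd_bits.
Qed.

(** * Arithmetic of unreduced fractions *)

Definition tradd (a q : tree) : tree :=
  Cons (tadd (tmul (tree_hd a) (tree_tl q)) (tmul (tree_tl a) (tree_hd q)))
       (tmul (tree_tl a) (tree_tl q)).

Lemma polytime_radd f g : polytime f -> polytime g -> polytime (fun a => tradd (f a) (g a)).
Proof.
move=> pf pg; apply: polytime_cons; last by apply: polytime_mul; polytime_tac.
by apply: polytime_add; apply: polytime_mul; polytime_tac.
Qed.

Definition trzero := Cons Nil (Cons ttrue Nil).

Definition trsum (l : tree) : tree :=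
  tloop (fun z => tradd (tree_hd (tree_tl z)) (tree_hd z)) l trzero Nil.

(** Without reduction, numerator and denominator still gain only a number of digits linear in the
    new summand. For this the accumulator must be the first factor of the products in [tradd]: in
    [bit_len_mul] the first length has coefficient 1 and the second coefficient 2. *)
Lemma polytime_rsum f : polytime f -> polytime (fun a => trsum (f a)).
Proof.
move=> pf; apply: (polytime_loop
  (mu := fun t => maxn (tree_size t)
     (8 * maxn (bit_len (tree_hd t)) (bit_len (tree_tl t)) + 3)) (K := 32)).
- by apply: polytime_radd; polytime_tac.
- move=> t; have := bit_len_size (tree_hd t); have := bit_len_size (tree_tl t).
  by have := tree_size_hd t; have := tree_size_tl t; have := tree_size_gt0 t; lia.
- move=> q a env /=.
  have := tree_size_bits (tadd_bits (tmul (tree_hd a) (tree_tl q)) (tmul (tree_tl a) (tree_hd q))).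
  have := tree_size_bits (tmul_bits (tree_tl a) (tree_tl q)).
  rewrite bit_len_add.
  have := bit_len_mul (tree_hd a) (tree_tl q); have := bit_len_mul (tree_tl a) (tree_hd q).
  have := bit_len_mul (tree_tl a) (tree_tl q).
  have := bit_len_size (tree_hd q); have := bit_len_size (tree_tl q).
  by have := tree_size_hd q; have := tree_size_tl q; have := tree_size_gt0 env; lia.
- by [].
- by polytime_tac.
- by polytime_tac.
Qed.

Definition tratio (t : tree) : rat := ((tval (tree_hd t))%:R / (tval (tree_tl t))%:R)%R.

Definition is_tratio (t : tree) : bool := tval (tree_tl t) != 0.

Lemma is_tratio_add a q : is_tratio a -> is_tratio q -> is_tratio (tradd a q).
Proof. by rewrite /is_tratio /= tval_mul muln_eq0 negb_or => -> ->. Qed.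

Lemma tratio_add a q : is_tratio a -> is_tratio q ->
  tratio (tradd a q) = (tratio a + tratio q)%R.
Proof.
rewrite /is_tratio -(pnatr_eq0 rat) -(pnatr_eq0 rat (tval (tree_tl q))) => a0 q0.
rewrite /tratio /= tval_add !tval_mul natrD !natrM.
by field; apply/andP.
Qed.

Lemma trsumE l : all is_tratio (elems l) ->
  is_tratio (trsum l) /\ tratio (trsum l) = (\sum_(q <- elems l) tratio q)%R.
Proof.
rewrite /trsum /tloop => sl.
suff sumP s a : is_tratio a -> all is_tratio s ->
    let r := foldl (fun acc x => tradd acc x) a s in
    is_tratio r /\ tratio r = (tratio a + \sum_(q <- s) tratio q)%R.
  have [? ->] := sumP _ trzero isT sl; split=> //.
  by rewrite {1}/tratio /= mul0r add0r.
elim: s a => [|q s IH] a a0 /=; first by rewrite big_nil addr0.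
move=> /andP[q0 /(IH _ (is_tratio_add a0 q0))[? ->]]; split=> //.
by rewrite big_cons tratio_add // addrA.
Qed.

Definition trle (a b : tree) : tree :=
  tle (tmul (tree_hd a) (tree_tl b)) (tmul (tree_hd b) (tree_tl a)).

Lemma polytime_rle f g : polytime f -> polytime g -> polytime (fun a => trle (f a) (g a)).
Proof.
move=> pf pg; apply: polytime_le; apply: polytime_mul; by polytime_tac.
Qed.

Lemma truthy_trle a b : is_tratio a -> is_tratio b ->
  truthy (trle a b) = (tratio a <= tratio b)%R.
Proof.
rewrite /is_tratio -!lt0n -!(ltr0n rat) => a0 b0.
rewrite truthy_tle !tval_mul /tratio.
by rewrite ler_pdivrMr // mulrAC ler_pdivlMr // -!natrM ler_nat.
Qed.

Lemma is_tratio_enc q : is_tratio (enc_rat q).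
Proof. by rewrite /is_tratio /= tval_enc_bin absz_eq0 denq_neq0. Qed.

Lemma tratio_enc q : (0 <= q)%R -> tratio (enc_rat q) = q.
Proof.
move=> q0; rewrite /tratio /= !tval_enc_bin.
rewrite -{3}(divq_num_den q); congr (_ / _)%R; rewrite -[LHS]/((Posz _)%:~R)%R; congr (_%:~R)%R.
  by rewrite gez0_abs // numq_ge0.
by rewrite absz_denq.
Qed.

(** * The packing program *)

Lemma tree_size_iter_tl k t : tree_size (iter k tree_tl t) <= tree_size t.
Proof. by elim: k => //= k; apply: leq_trans; apply: tree_size_tl. Qed.

Lemma iter_tlE k t : iter k tree_tl t = tlist (drop k (elems t)).
Proof.
elim: k => [|k IH]; first by rewrite drop0 elemsK.
rewrite iterS IH -addn1 addnC -drop_drop drop1.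
by case: (drop k _).
Qed.

Lemma hd_iter_tlE j t : tree_hd (iter j tree_tl t) = nth Nil (elems t) j.
Proof.
by rewrite iter_tlE -[in RHS](addn0 j) -nth_drop; case: (drop j _).
Qed.

Lemma polytime_iter_tl k f : polytime f -> polytime (fun a => iter k tree_tl (f a)).
Proof. by move=> pf; elim: k => //= k; apply: polytime_tl. Qed.

(** The accumulator holds the unread rest of the list and the results, newest first. [F] is given
    the whole rest; the functions used below look only at its first [k] items. *)
Definition tcollect_step (F : tree -> tree) (k : nat) (z : tree) : tree :=
  let acc := tree_hd (tree_tl z) in
  tif (tree_hd acc)
    (Cons (iter k tree_tl (tree_hd acc))
          (Cons (F (Cons (tree_hd acc) (tree_tl (tree_tl z)))) (tree_tl acc)))
    acc.

(* One iteration per element of [l] is more than needed; the surplus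
   iterations leave the accumulator unchanged. *)
Definition tcollect (F : tree -> tree) (k : nat) (l g : tree) : tree :=
  tree_tl (tloop (tcollect_step F k) l (Cons l Nil) g).

(** The size of a new result is polynomial, not linear, so the additive criterion does not fit. But
    the unread rest never grows, hence one value of the polynomial of [F] bounds all increments. *)
Lemma polytime_collect F k f g : polytime F -> polytime f -> polytime g ->
  polytime (fun a => tcollect F k (f a) (g a)).
Proof.
move=> pF pf pg; apply: polytime_tl.
have /polytime_horner[_ [_ [p [_ szF]]]] := pF.
pose G n := n + n * (p.[n + n + 1]%R + 5).
have [q Gq] : poly_bounded G by rewrite /G; poly_bound.
apply: (@polytime_comp (fun a => tloop (tcollect_step F k) (tree_hd a)
  (tree_hd (tree_tl a)) (tree_tl (tree_tl a)))
  (fun a => Cons (f a) (Cons (Cons (f a) Nil) (g a)))); last by polytime_tac.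
apply: (polytime_loop_raw (q := q)).
  apply: polytime_if; polytime_tac.
  - by apply: polytime_iter_tl; polytime_tac.
  - by apply: polytime_comp pF _; polytime_tac.
move=> l acc env.
have bnd n : tree_size (tree_hd acc) <= n -> tree_size (tloop (tcollect_step F k) l acc env)
    <= tree_size acc + tree_size l * (p.[n + tree_size env + 1]%R + 5).
  rewrite /tloop; elim: l acc => [|x _ l IH] acc accn; first by rewrite /=; lia.
  rewrite [elems _]/= [foldl _ _ _]/=; set acc' := tcollect_step _ _ _.
  suff [acc'n acc'sz] : tree_size (tree_hd acc') <= n /\
      tree_size acc' <= tree_size acc + p.[n + tree_size env + 1]%R + 5.
    by apply: leq_trans (IH _ acc'n) _; rewrite /=; nia.
  rewrite /acc' /tcollect_step /=.
  case: acc accn @acc' => [|[|r1 r2] out] /= accn; try by lia.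
  have := tree_size_iter_tl k (Cons r1 r2) => /=.
  have := szF (Cons (Cons r1 r2) env).
  have : p.[tree_size (Cons (Cons r1 r2) env)]%R <= p.[n + tree_size env + 1]%R.
    by apply: horner_nat_homo => /=; move: accn; rewrite /=; lia.
  by lia.
set n := (_ + _ + _)%R; apply: leq_trans (Gq n).
apply: leq_trans (bnd (tree_size acc) (tree_size_hd acc)) _; rewrite /G.
have := @horner_nat_homo p (tree_size acc + tree_size env + 1) (n + n + 1).
have -> : tree_size acc + tree_size env + 1 <= n + n + 1 by rewrite /n; lia.
move=> /(_ isT) le_p; apply: leq_add; first by rewrite /n; lia.
by apply: leq_mul; [rewrite /n; lia|apply: leq_add le_p _].
Qed.

Lemma elems_tcollect F k m l g : 0 < k -> size (elems l) = k * m ->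
  elems (tcollect F k l g) =
  rev [seq F (Cons (tlist (drop (k * q) (elems l))) g) | q <- iota 0 m].
Proof.
move=> k0 szl; rewrite /tcollect /tloop.
have ms : m <= size (elems l) by rewrite szl; nia.
(* Here [s] serves only as a supply of iterations, [L] is the unread rest, and [m'] is the number of
   windows left in it. *)
suff H s L out m' : size L = k * m' -> m' <= size s ->
    elems (tree_tl (foldl (fun acc x => tcollect_step F k (Cons x (Cons acc g)))
      (Cons (tlist L) out) s))
    = rev [seq F (Cons (tlist (drop (k * q) L)) g) | q <- iota 0 m'] ++ elems out.
  by have := H _ _ Nil _ szl ms; rewrite elemsK cats0.
elim: s L out m' => [|x s IH] L out [|m'] //= szL ms'.
  have -> : L = [::] by apply: size0nil; lia.
  by rewrite {2}/tcollect_step /=; apply: (IH [::] out 0) => //=; rewrite muln0.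
case: L szL => [|y L] szL; first by move: szL; rewrite /= mulnS; lia.
rewrite {2}/tcollect_step [tree_hd (tree_tl _)]/= /=.
rewrite -[Cons y (foldr _ _ _)]/(tlist (y :: L)) iter_tlE tlistK.
rewrite (IH _ _ m'); [|by rewrite size_drop szL mulnS addKn|by []].
rewrite /= rev_cons cat_rcons muln0 drop0 (iotaDl 1 0) -map_comp; congr (rev _ ++ _).
by apply: eq_map => q; rewrite /= drop_drop add1n mulnS addnC.
Qed.

(** The positions [js] are constants of the program, since [k] is fixed; the selection is unrolled
    rather than looped. *)
Definition tpick (js : seq nat) (r : tree) : tree :=
  foldr (fun j t => Cons (tree_hd (iter j tree_tl r)) t) Nil js.

Lemma tpickE js r : tpick js r = tlist [seq nth Nil (elems r) j | j <- js].
Proof. by elim: js => //= j js ->; rewrite hd_iter_tlE. Qed.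

Lemma polytime_pick js f : polytime f -> polytime (fun a => tpick js (f a)).
Proof.
move=> pf; elim: js => [|j js IH] /=; first exact: polytime_const.
by apply: polytime_cons IH; apply: polytime_hd; apply: polytime_iter_tl.
Qed.

(** An edge is a pair of positions in the list [tree_hd z]. The vertices found there are unary
    codes, hence usable directly as indices into the weight matrix [tree_tl z]. *)
Definition tedges_weight (es : seq (nat * nat)) (z : tree) : tree :=
  foldr (fun e t => tradd t
      (tnth (tnth (tree_tl z) (tree_hd (iter e.1 tree_tl (tree_hd z))))
            (tree_hd (iter e.2 tree_tl (tree_hd z))))) trzero es.

Lemma polytime_edges_weight es : polytime (tedges_weight es).
Proof.
elim: es => [|e es IH]; first exact: polytime_const.
apply: polytime_radd => //; apply: polytime_nth; [apply: polytime_nth|];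
  polytime_tac; apply: polytime_iter_tl; polytime_tac.
Qed.

Definition trot (l : tree) : tree := trev (Cons (tree_hd l) (trev (tree_tl l))).

Lemma elems_trot l : 0 < size (elems l) -> elems (trot l) = rot 1 (elems l).
Proof.
case: l => //= x l _; rewrite /trot elems_trev /= elems_trev rev_cons revK.
by rewrite rot1_cons.
Qed.

Lemma elems_iter_trot s l : s <= size (elems l) -> elems (iter s trot l) = rot s (elems l).
Proof.
elim: s => [|s IH] sl; first by rewrite rot0.
have {}IH := IH (ltnW sl); rewrite iterS elems_trot IH; last by rewrite size_rot; lia.
by rewrite -rotS.
Qed.

Lemma polytime_iter_rot s f : polytime f -> polytime (fun a => iter s trot (f a)).
Proof.
move=> pf; elim: s => //= s IH.
by apply: polytime_rev; apply: polytime_cons; [|apply: polytime_rev]; polytime_tac.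
Qed.

(* A candidate is stored together with its weight: [Cons weight packing]. *)
Definition tcand (k s : nat) (js : seq nat) (z : tree) : tree :=
  Cons (trsum (tcollect (tedges_weight (zip js (rot 1 js))) k (iter s trot (tree_tl z)) (tree_hd z)))
       (tcollect (fun z => tpick js (tree_hd z)) k (iter s trot (tree_tl z)) (tree_hd z)).

Lemma polytime_cand k s js : polytime (tcand k s js).
Proof.
apply: polytime_cons; [apply: polytime_rsum|]; apply: polytime_collect; polytime_tac.
- exact: polytime_edges_weight.
- by apply: polytime_iter_rot; polytime_tac.
- by apply: polytime_pick; polytime_tac.
- by apply: polytime_iter_rot; polytime_tac.
Qed.

Fixpoint tbest (I : Type) (f : I -> tree -> tree) (r : seq I) (z : tree) : tree :=
  if r is i :: r' then
    tif (trle (tree_hd (tbest f r' z)) (tree_hd (f i z))) (f i z) (tbest f r' z)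
  else Cons trzero Nil.

Lemma polytime_best (I : Type) (f : I -> tree -> tree) r :
  (forall i, polytime (f i)) -> polytime (tbest f r).
Proof.
move=> pf; elim: r => [|i r IH] /=; first exact: polytime_const.
by apply: polytime_if => //; apply: polytime_rle; apply: polytime_hd.
Qed.

(** The default of weight 0 is never returned: weights are non-negative and ties favour the
    candidate compared last. *)
Lemma tbestP (I : eqType) (f : I -> tree -> tree) r z : r != [::] ->
    {in r, forall i, is_tratio (tree_hd (f i z)) /\ (0 <= tratio (tree_hd (f i z)))%R} ->
  exists2 i, i \in r & tbest f r z = f i z /\
    {in r, forall j, (tratio (tree_hd (f j z)) <= tratio (tree_hd (f i z)))%R}.
Proof.
elim: r => // i r IH _ fr /=.
have [fi0 fi_ge0] := fr i (mem_head _ _).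
have [r0|rN0] := eqVneq r [::].
  exists i; first exact: mem_head.
  split; last by move=> j; rewrite r0 inE => /eqP->.
  have : truthy (trle trzero (tree_hd (f i z))).
    by rewrite truthy_trle // {1}/tratio /= mul0r.
  by rewrite r0 /=; case: (trle _ _).
have [|j jr [-> jmax]] := IH rN0.
  by move=> j jr; apply: fr; rewrite inE jr orbT.
have [|fj0 fj_ge0] := fr j; first by rewrite inE jr orbT.
have := truthy_trle fj0 fi0; case: (trle _ _) => [|??] /= /esym.
  move=> /negbT; rewrite -ltNge => lt_ij; exists j; first by rewrite inE jr orbT.
  by split=> // j'; rewrite inE => /predU1P[->|/jmax//]; apply: ltW.
move=> le_ji; exists i; first exact: mem_head.
by split=> // j'; rewrite inE => /predU1P[->//|/jmax/le_trans]; apply.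
Qed.

(** * Meaning of the program on encoded graphs and tours *)

Lemma enc_seqE (T : Type) (enc : T -> tree) s : enc_seq enc s = tlist (map enc s).
Proof. by elim: s => //= x s ->. Qed.

Lemma size_elems_unary n : size (elems (enc_unary n)) = n.
Proof. by elim: n => //= n ->. Qed.

Lemma tnth_enc_graph (G : metric_graph) (u v : vertex G) :
  tnth (tnth (enc_graph G) (enc_vertex u)) (enc_vertex v) = enc_rat (weight u v).
Proof.
rewrite !tnthE !size_elems_unary /enc_graph enc_seqE tlistK.
rewrite (nth_map u) ?size_enum_ord // nth_ord_enum enc_seqE tlistK.
by rewrite (nth_map u) ?size_enum_ord // nth_ord_enum.
Qed.

Definition edges_weight (G : metric_graph) (es : seq (vertex G * vertex G)) : rat :=
  (\sum_(e <- es) weight e.1 e.2)%R.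

Definition window_cycle (T : Type) (x0 : T) (c : seq T) (k : nat) (js : seq nat) (q : nat) : seq T :=
  [seq nth x0 c (k * q + j) | j <- js].

(** The reversal reproduces the order in which [tcollect] accumulates its results. *)
Definition window_packing (T : Type) (x0 : T) (c : seq T) (k m : nat) (js : seq nat) : seq (seq T) :=
  rev [seq window_cycle x0 c k js q | q <- iota 0 m].

Lemma tedges_weightE (G : metric_graph) (x0 : vertex G) (c : seq (vertex G)) d es :
    all (fun e => (d + e.1 < size c) && (d + e.2 < size c)) es ->
  let r := tedges_weight es (Cons (tlist (drop d (map (@enc_vertex G) c))) (enc_graph G)) in
  is_tratio r /\ tratio r =
    edges_weight [seq (nth x0 c (d + e.1), nth x0 c (d + e.2)) | e <- es].
Proof.
rewrite /edges_weight; elim: es => [|[o o'] es IH] /=.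
  by rewrite big_nil /tratio /= mul0r.
move=> /andP[/andP[oc oc'] /IH[r0 rE]].
rewrite !hd_iter_tlE tlistK !nth_drop !(nth_map x0) // tnth_enc_graph.
split; first exact: is_tratio_add r0 (is_tratio_enc _).
by rewrite tratio_add ?is_tratio_enc // rE tratio_enc ?weight_ge0 // big_cons addrC.
Qed.

Lemma tcandE (G : metric_graph) (x0 : vertex G) (c : seq (vertex G)) k m s js :
    0 < k -> size c = k * m -> s <= size c -> all (fun j => j < k) js ->
  let r := tcand k s js (Cons (enc_graph G) (enc_cycle c)) in
  [/\ is_tratio (tree_hd r),
      tratio (tree_hd r) = (\sum_(q < m) edges_weight
        (let w := window_cycle x0 (rot s c) k js q in zip w (rot 1 w)))%R
    & tree_tl r = enc_packing (window_packing x0 (rot s c) k m js)].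
Proof.
move=> k0 szc sc jsk r.
have lE : elems (iter s trot (enc_cycle c)) = map (@enc_vertex G) (rot s c).
  by rewrite elems_iter_trot /enc_cycle enc_seqE tlistK ?size_map // map_rot.
have szl : size (elems (iter s trot (enc_cycle c))) = k * m.
  by rewrite lE size_map size_rot.
have jmP j q : j \in js -> q < m -> k * q + j < size (rot s c).
  move=> /(allP jsk) jk qm; rewrite size_rot szc.
  by apply: leq_trans (_ : k * q.+1 <= _); [rewrite mulnS; lia|rewrite leq_mul2l qm orbT].
have esP q : q < m -> all (fun e => (k * q + e.1 < size (rot s c)) &&
    (k * q + e.2 < size (rot s c))) (zip js (rot 1 js)).
  move=> qm; apply/allP => -[o o'] ee /=; rewrite !jmP //.
    by rewrite -(mem_rot 1) -(@unzip2_zip _ _ js (rot 1 js)) ?size_rot //; apply: (map_f snd ee).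
  by rewrite -(@unzip1_zip _ _ js (rot 1 js)) ?size_rot //; apply: (map_f fst ee).
have mapE q : [seq (nth x0 (rot s c) (k * q + e.1), nth x0 (rot s c) (k * q + e.2))
       | e <- zip js (rot 1 js)] =
    let w := window_cycle x0 (rot s c) k js q in zip w (rot 1 w).
  rewrite /= /window_cycle -map_rot.
  by elim: js (rot 1 js) {jsk r jmP esP} => [|j js IH] [|j' js'] //=; rewrite IH.
set L := map (@enc_vertex G) (rot s c) in lE.
have itemP q : q < m -> let t := tedges_weight (zip js (rot 1 js))
     (Cons (tlist (drop (k * q) L)) (enc_graph G)) in is_tratio t /\
     tratio t = edges_weight (let w := window_cycle x0 (rot s c) k js q in zip w (rot 1 w)).
  by move=> qm; rewrite -mapE; apply: tedges_weightE (esP q qm).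
have cE F := elems_tcollect F (enc_graph G) k0 szl.
have mem_iota_m q : q \in iota 0 m -> q < m by rewrite mem_iota.
rewrite /r /tcand /=.
have [|r0 rE] := @trsumE (tcollect (tedges_weight (zip js (rot 1 js))) k
    (iter s trot (enc_cycle c)) (enc_graph G)).
  rewrite cE all_rev all_map; apply/allP => q /mem_iota_m qm /=.
  by rewrite lE; have [] := itemP q qm.
split=> //.
  rewrite rE cE big_rev big_map -{1}(subn0 m) big_mkord.
  by apply: eq_bigr => q _; rewrite lE; have [] := itemP q (ltn_ord q).
rewrite -[LHS]elemsK cE /enc_packing enc_seqE /window_packing map_rev -!map_comp.
congr (tlist (rev _)); apply/eq_in_map => q /mem_iota_m qm /=.
rewrite lE tpickE tlistK /enc_cycle enc_seqE -map_comp; congr tlist.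
by apply/eq_in_map => j jjs /=; rewrite nth_drop (nth_map x0) //; apply: jmP.
Qed.

(** * Paths and closed walks *)

Local Open Scope ring_scope.

Fixpoint path_weight (G : metric_graph) (p : seq (vertex G)) : rat :=
  if p is x :: s then (if s is y :: _ then weight x y else 0) + path_weight s else 0.

(** Edges are taken by position instead of by [next], so that lists can be cut, reversed and joined
    without tracking uniqueness; on duplicate-free lists this is [cycle_weight]. *)
Definition closed_weight (G : metric_graph) (p : seq (vertex G)) : rat :=
  edges_weight (zip p (rot 1 p)).

Lemma closed_weightE (G : metric_graph) (x0 : vertex G) (p : seq (vertex G)) : p != [::] ->
  closed_weight p = path_weight p + weight (last x0 p) (head x0 p).
Proof.
case: p => // x s _; rewrite /closed_weight rot1_cons [head _ _]/= [last _ _]/=.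
have H z : edges_weight (zip (x :: s) (rcons s z)) = path_weight (x :: s) + weight (last x s) z.
  rewrite /edges_weight; elim: s x => [|y s IH] x /=; first by rewrite big_cons big_nil !add0r addr0.
  by rewrite big_cons IH /= addrA.
exact: H.
Qed.

Lemma path_weight_cat (G : metric_graph) (x0 : vertex G) (p q : seq (vertex G)) :
  p != [::] -> q != [::] ->
  path_weight (p ++ q) = path_weight p + weight (last x0 p) (head x0 q) + path_weight q.
Proof.
case: q => // y q; elim: p => // x [|z p] IH _ _ /=; first by rewrite !add0r.
by have /= -> := IH isT isT; rewrite !addrA.
Qed.

Lemma path_weight_rev (G : metric_graph) (p : seq (vertex G)) : path_weight (rev p) = path_weight p.
Proof.
elim: p => // x [|y p] IH //.
rewrite rev_cons -cats1 (path_weight_cat x) ?IH //; last by rewrite -size_eq0 size_rev.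
by rewrite rev_cons last_rcons /= weight_sym; ring.
Qed.

Lemma path_weight_nth (G : metric_graph) (x0 : vertex G) (p : seq (vertex G)) :
  path_weight p = \sum_(0 <= i < (size p).-1) weight (nth x0 p i) (nth x0 p i.+1).
Proof.
elim: p => [|x [|y p] IH]; [by rewrite big_geq|by rewrite big_geq //= addr0|].
by rewrite [LHS]/= -/(path_weight (y :: p)) IH /= big_nat_recl.
Qed.

Lemma closed_weight_cat (G : metric_graph) (x0 : vertex G) (p q : seq (vertex G)) :
  p != [::] -> q != [::] -> closed_weight (p ++ q) =
  path_weight p + weight (last x0 p) (head x0 q) + path_weight q + weight (last x0 q) (head x0 p).
Proof.
move=> p0 q0; rewrite (closed_weightE x0); last by case: p p0.
by rewrite (path_weight_cat x0) // last_cat; case: p p0 => // x p _; case: q q0.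
Qed.

Lemma closed_weight_catC (G : metric_graph) (p q : seq (vertex G)) :
  closed_weight (p ++ q) = closed_weight (q ++ p).
Proof.
case: p => [|x p]; first by rewrite cats0.
case: q => [|y q]; first by rewrite cats0.
by rewrite !(closed_weight_cat x) // -!addrA addrC; ring.
Qed.

Lemma cycle_weightE (G : metric_graph) (c : seq (vertex G)) : uniq c ->
  cycle_weight c = closed_weight c.
Proof.
move=> uc; rewrite /cycle_weight /closed_weight /edges_weight.
suff -> : zip c (rot 1 c) = [seq (u, next c u) | u <- c] by rewrite big_map.
case: c uc => // x s uc; rewrite rot1_cons; apply: (@eq_from_nth _ (x, x)).
  by rewrite size_zip size_rcons size_map minnn.
rewrite size_zip size_rcons minnn => i si.
rewrite nth_zip ?size_rcons // (nth_map x) //; congr pair.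
(* For the last vertex, [next] reads past the end of [s] and returns the default [x], the entry that
   [rcons] puts there. *)
rewrite next_nth mem_nth // index_uniq // nth_rcons.
have [//|le_si] := ltnP i (size s); rewrite nth_default //.
by have -> : i = size s; [move: si => /=; lia|rewrite eqxx].
Qed.

(** * Joining the cycles of a packing into one tour *)

(** By the triangle inequality through the end of [Q], the links from there to the two ends of the
    next path together weigh at least the edge between these ends. The better direction recovers
    half of it. *)
Lemma join_paths (G : metric_graph) (x0 : vertex G) (Ps : seq (seq (vertex G))) Q :
    Q != [::] -> all (fun P => P != [::]) Ps ->
  exists H, [/\ perm_eq H (Q ++ flatten Ps), head x0 H = head x0 Q, H != [::]
    & path_weight Q + \sum_(P <- Ps) (path_weight P + weight (last x0 P) (head x0 P) / 2)
      <= path_weight H].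
Proof.
elim: Ps Q => [|P Ps IH] Q Q0 /=.
  by exists Q; split=> //; rewrite ?cats0 // big_nil addr0.
move=> /andP[P0 Ps0].
have [P' [P'0 P'P le_P']] : exists P', [/\ P' != [::], perm_eq P' P &
    path_weight P + weight (last x0 P) (head x0 P) / 2
      <= weight (last x0 Q) (head x0 P') + path_weight P'].
  have tri := weight_triangle (last x0 P) (head x0 P) (last x0 Q).
  have [le_w|le_w] := lerP (weight (last x0 P) (head x0 P) / 2) (weight (last x0 Q) (head x0 P)).
    by exists P; split=> //; lra.
  exists (rev P); split; rewrite ?perm_rev //; first by rewrite -size_eq0 size_rev size_eq0.
  have -> : head x0 (rev P) = last x0 P.
    by case/lastP: P {P0 tri le_w} => // P y; rewrite rev_rcons last_rcons.
  by rewrite path_weight_rev; move: tri; rewrite (weight_sym (last x0 P) (last x0 Q)); lra.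
have QP'0 : Q ++ P' != [::] by case: (Q) Q0.
have [H [HP Hhd H0 Hw]] := IH _ QP'0 Ps0.
exists H; split=> //.
- by apply: perm_trans HP _; rewrite -catA perm_cat2l perm_cat2r.
- by rewrite Hhd; case: (Q) Q0.
- by move: Hw; rewrite (path_weight_cat x0) // big_cons; lra.
Qed.

(* Both links of the path that closes the tour count in full, which pays for
   the path at which the tour started. *)
Lemma close_path (G : metric_graph) (x0 : vertex G) (H P : seq (vertex G)) :
    H != [::] -> P != [::] ->
  exists2 C, perm_eq C (H ++ P) &
    path_weight H + path_weight P + weight (last x0 P) (head x0 P) <= closed_weight C.
Proof.
move=> H0 P0.
have P0' : rev P != [::] by rewrite -size_eq0 size_rev size_eq0.
have hdr : head x0 (rev P) = last x0 P.
  by case/lastP: P {P0 P0'} => // P y; rewrite rev_rcons last_rcons.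
have lar : last x0 (rev P) = head x0 P by case: P {P0 P0' hdr} => // y P; rewrite rev_cons last_rcons.
have tri1 := weight_triangle (last x0 P) (head x0 P) (last x0 H).
have tri2 := weight_triangle (last x0 P) (head x0 P) (head x0 H).
have s1 := weight_sym (last x0 P) (last x0 H).
have s2 := weight_sym (head x0 P) (head x0 H).
have c1 := closed_weight_cat x0 H0 P0; have c2 := closed_weight_cat x0 H0 P0'.
rewrite hdr lar path_weight_rev in c2.
have [le_w|lt_w] := lerP (weight (last x0 P) (head x0 P))
  (weight (last x0 H) (head x0 P) + weight (last x0 P) (head x0 H)).
  by exists (H ++ P); rewrite // c1; lra.
by exists (H ++ rev P); rewrite ?c2 ?perm_cat2l ?perm_rev //; lra.
Qed.

Lemma min_le_mean (n : nat) (a : nat -> rat) : (0 < n)%N ->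
  exists2 i, (i < n)%N & n%:R * a i <= \sum_(0 <= j < n) a j.
Proof.
case: n => // n _; case: (@arg_minP _ _ _ (@ord0 n) predT (fun i : 'I_n.+1 => a i) isT) => i _ imin.
exists i => //; rewrite big_mkord mulr_natl -[X in _ *+ X]card_ord -sumr_const.
by apply: ler_sum => j _; apply: imin.
Qed.

(** The lightest edge weighs at most the mean, and rotating the cycle turns that edge into the
    closing one. *)
Lemma drop_lightest_edge (G : metric_graph) (x0 : vertex G) (c : seq (vertex G)) : c != [::] ->
  exists2 P, perm_eq P c & [/\ P != [::],
    closed_weight c = path_weight P + weight (last x0 P) (head x0 P)
    & (size c)%:R * weight (last x0 P) (head x0 P) <= closed_weight c].
Proof.
move=> c0; have sc : (0 < size c)%N by rewrite lt0n size_eq0.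
(* The last index stands for the closing edge, which is not between consecutive positions. *)
pose a i := if i.+1 == size c then weight (last x0 c) (head x0 c)
            else weight (nth x0 c i) (nth x0 c i.+1).
have [i ic ai] := min_le_mean a sc.
have aE : \sum_(0 <= j < size c) a j = closed_weight c.
  rewrite (closed_weightE x0) // (path_weight_nth x0) -{1}(prednK sc).
  rewrite big_nat_recr //= {2}/a prednK // eqxx; congr (_ + _).
  by apply: eq_big_nat => j jc; rewrite /a ifN //; lia.
rewrite aE /a in ai; have [ei|ni] := eqVneq i.+1 (size c).
  by exists c => //; rewrite -(closed_weightE x0) //; split=> //; move: ai; rewrite ei eqxx.
rewrite (negbTE ni) in ai; pose p := take i.+1 c; pose q := drop i.+1 c.
have q0 : q != [::] by rewrite -size_eq0 size_drop subn_eq0 -ltnNge ltn_neqAle ni ic.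
have pE : p = rcons (take i c) (nth x0 c i) by rewrite /p (take_nth x0).
have p0 : p != [::] by rewrite pE; case: (take _ _).
have lE : last x0 (q ++ p) = nth x0 c i by rewrite last_cat pE last_rcons.
have hE : head x0 (q ++ p) = nth x0 c i.+1.
  by rewrite -[i.+1]addn0 -nth_drop -/q; case: (q) q0.
have qp0 : q ++ p != [::] by case: (q) q0.
exists (q ++ p); first by rewrite perm_catC cat_take_drop.
split; rewrite ?lE ?hE //.
by rewrite -lE -hE -(closed_weightE x0) // closed_weight_catC cat_take_drop.
Qed.

Lemma packing_tour (G : metric_graph) (k : nat) (C : seq (seq (vertex G))) :
    (0 < k)%N -> C != [::] -> all (fun c => size c == k) C ->
  exists2 H, perm_eq H (flatten C) &
    (1 - 1 / 2 / k%:R) * \sum_(c <- C) closed_weight c <= closed_weight H.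
Proof.
move=> k0 C0 Ck.
have [x0 _] : exists x0 : vertex G, True.
  by case: C C0 Ck => // -[|x c] C _ /=; [move: k0; case: k|exists x].
have kR : 0 < k%:R :> rat by rewrite ltr0n.
have [Ps [PsC szPs Ps0 Psw]] : exists Ps, [/\ perm_eq (flatten Ps) (flatten C), size Ps = size C,
    all (fun P => P != [::]) Ps
  & (1 - 1 / 2 / k%:R) * \sum_(c <- C) closed_weight c
    <= \sum_(P <- Ps) (path_weight P + weight (last x0 P) (head x0 P) / 2)].
  elim: C Ck {C0} => [|c C IH] /=; first by exists [::]; rewrite !big_nil mulr0.
  move=> /andP[/eqP szc /IH[Ps [PsC szPs Ps0 Psw]]].
  have c0 : c != [::] by rewrite -size_eq0 szc -lt0n.
  have [P Pc [P0 cE le_e]] := drop_lightest_edge x0 c0.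
  exists (P :: Ps); split; [exact: perm_cat|by rewrite /= szPs|by rewrite /= P0|].
  rewrite !big_cons mulrDr; apply: lerD Psw; rewrite szc in le_e.
  have : weight (last x0 P) (head x0 P) <= closed_weight c / k%:R by rewrite ler_pdivlMr // mulrC.
  have -> : (1 - 1 / 2 / k%:R) * closed_weight c = closed_weight c - closed_weight c / k%:R / 2.
    by field; rewrite gt_eqF.
  by rewrite {1 3}cE; lra.
case: Ps PsC szPs Ps0 Psw => [|P [|P1 Ps]] PsC szPs Ps0 Psw.
- by case: C C0 szPs {PsC Psw Ck}.
(* A single cycle is already a tour and recovers all of its dropped edge. *)
- exists P; first by rewrite -(perm_catCA P [::]) in PsC *; move: PsC; rewrite /= cats0.
  apply: le_trans Psw _; rewrite big_cons big_nil addr0.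
  have P0 : P != [::] by case/andP: Ps0.
  by rewrite (closed_weightE x0) // lerD2l; have := weight_ge0 (last x0 P) (head x0 P); lra.
(* The tour starts with [P], whose edge is lost, and closes with [P1], whose edge is recovered in
   full. With the heavier edge at [P1], this is at least half of both. *)
wlog le_e : P P1 PsC szPs Ps0 Psw / weight (last x0 P) (head x0 P) <= weight (last x0 P1) (head x0 P1).
  move=> wl; have [le_e|/ltW le_e] :=
    lerP (weight (last x0 P) (head x0 P)) (weight (last x0 P1) (head x0 P1)).
    exact: (wl P P1).
  apply: (wl P1 P) => {wl}; [by rewrite /= perm_catCA|exact: szPs| | |exact: le_e].
    by move: Ps0 => /= /and3P[-> -> ->].
  by move: Psw; rewrite !big_cons addrCA.
have /and3P[P0 P10 Ps0'] := Ps0.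
have [H [HP _ H0 Hw]] := join_paths x0 P0 Ps0'.
have [T TP Tw] := close_path x0 H0 P10.
exists T.
  apply: perm_trans TP (perm_trans _ PsC).
  by rewrite perm_sym /= perm_catCA perm_catC perm_cat2r perm_sym.
by apply: le_trans Psw _; rewrite !big_cons; lra.
Qed.

(** * Cutting a tour into cycles *)

Definition flip_order (k i : nat) : seq nat := iota 0 i ++ rev (iota i (k - i)).

Lemma perm_flip_order k i : (i <= k)%N -> perm_eq (flip_order k i) (iota 0 k).
Proof.
move=> ik; rewrite -[in iota 0 k](subnKC ik) iotaD perm_cat2l perm_rev.
exact: perm_refl.
Qed.

Lemma path_weight_iota (G : metric_graph) (u : nat -> vertex G) (i l : nat) :
  path_weight [seq u o | o <- iota i l.+1] = \sum_(i <= o < i + l) weight (u o) (u o.+1).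
Proof.
rewrite (path_weight_nth (u 0%N)) size_map size_iota -{3}[i]add0n big_addn addKn.
apply: eq_big_nat => j /andP[_ jl]; rewrite !(nth_map 0%N) ?size_iota //; try lia.
by rewrite !nth_iota; [rewrite addnS addnC|lia|lia].
Qed.

Lemma last_map_iota (T : Type) (u : nat -> T) y i l :
  last y [seq u o | o <- iota i l.+1] = u (i + l)%N.
Proof. by rewrite -addn1 iotaD map_cat last_cat. Qed.

Lemma flip_full_weight (G : metric_graph) (u : nat -> vertex G) (k : nat) :
  closed_weight [seq u o | o <- flip_order k.+1 k.+1] =
  \sum_(0 <= o < k) weight (u o) (u o.+1) + weight (u k) (u 0%N).
Proof.
rewrite /flip_order subnn cats0 (closed_weightE (u 0%N)) // path_weight_iota add0n.
by rewrite last_map_iota.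
Qed.

(** The reversed part runs from [u k] back to [u i.+1]. The edge after [u i] and the closing edge
    are thus exchanged for the chords from [u i] to [u k] and from [u i.+1] to [u 0]. *)
Lemma flip_weight (G : metric_graph) (u : nat -> vertex G) (k i : nat) : (i < k)%N ->
  closed_weight [seq u o | o <- flip_order k.+1 i.+1] =
  \sum_(0 <= o < k) weight (u o) (u o.+1) - weight (u i) (u i.+1)
    + weight (u i) (u k) + weight (u i.+1) (u 0%N).
Proof.
move=> ik; rewrite /flip_order map_cat map_rev.
have -> : (k.+1 - i.+1 = (k - i.+1).+1)%N by lia.
rewrite (closed_weight_cat (u 0%N)) //; last by rewrite -size_eq0 size_rev size_map size_iota.
rewrite path_weight_rev !path_weight_iota add0n subnKC // last_map_iota add0n.
have -> : head (u 0%N) (rev [seq u o | o <- iota i.+1 (k - i.+1).+1]) = u k.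
  rewrite -[(k - i.+1).+1]addn1 iotaD map_cat rev_cat /=.
  by congr u; lia.
have -> : last (u 0%N) (rev [seq u o | o <- iota i.+1 (k - i.+1).+1]) = u i.+1.
  by rewrite /= rev_cons last_rcons.
rewrite [head _ _]/= [in RHS](big_cat_nat (n := i)) //=; last by lia.
rewrite [\sum_(i <= _ < k) _]big_ltn //; lra.
Qed.

(** Two pairings of the same terms, shifted by one: the left one matches the edges from [u t.*2] to
    [u t.*2.+1], the right one the chords created by the flips. *)
Lemma sum_pairs (x : nat -> rat) (h : nat) :
  \sum_(0 <= t < h.+1) (x t.*2 + x t.*2.+1) =
  x 0%N + \sum_(1 <= t < h.+1) (x t.*2.-1 + x t.*2) + x h.*2.+1.
Proof.
elim: h => [|h IH]; first by rewrite big_nat1 big_geq // addr0.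
rewrite big_nat_recr // IH [in RHS]big_nat_recr //= doubleS /=.
by ring.
Qed.

(* The triangle inequality bounds the weight of the [2t]-th flip from below by
   [W - a (2t-1) + x (2t-1) + x (2t) - d], where [a], [x] and [d] are the path
   edges, the distances to [u 0] and the closing edge; since
   [x (2t) + x (2t+1) >= a (2t)], the sum over all flips leaves [-h d], which
   the [h] copies of the unflipped cycle cancel. *)
Lemma window_average (G : metric_graph) (u : nat -> vertex G) (k h : nat) :
  k = h.+1.*2 ->
  (k.-1)%:R * (\sum_(0 <= o < k.-1) weight (u o) (u o.+1))
    + \sum_(0 <= t < h.+1) weight (u t.*2) (u t.*2.+1)
    - \sum_(1 <= t < h.+1) weight (u t.*2.-1) (u t.*2)
  <= h.+1%:R * closed_weight [seq u o | o <- flip_order k k]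
     + \sum_(1 <= t < h.+1) closed_weight [seq u o | o <- flip_order k t.*2].
Proof.
rewrite doubleS => ->; rewrite flip_full_weight; set d := weight (u h.*2.+1) (u 0%N).
set W := \sum_(0 <= o < _) _; set x := fun o => weight (u 0%N) (u o).
have xd : x h.*2.+1 = d by rewrite /x weight_sym.
have flips : \sum_(1 <= t < h.+1) (W - weight (u t.*2.-1) (u t.*2) + (x t.*2.-1 + x t.*2) - d)
    <= \sum_(1 <= t < h.+1) closed_weight [seq u o | o <- flip_order h.*2.+2 t.*2].
  apply: ler_sum_nat => -[|t] // /andP[_ th]; rewrite doubleS [_.+2.-1]/= flip_weight; last by lia.
  have := weight_triangle (u 0%N) (u t.*2.+1) (u h.*2.+1).
  rewrite -/(x t.*2.+1) -/(x h.*2.+1) xd (weight_sym (u h.*2.+1)) (weight_sym (u t.*2.+2)) -/(x t.*2.+2).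
  by rewrite -/W; lra.
have pairs : \sum_(0 <= t < h.+1) weight (u t.*2) (u t.*2.+1)
    <= \sum_(0 <= t < h.+1) (x t.*2 + x t.*2.+1).
  apply: ler_sum_nat => t _; have := weight_triangle (u t.*2) (u t.*2.+1) (u 0%N).
  by rewrite (weight_sym (u t.*2) (u 0%N)).
rewrite sum_pairs xd {1}/x weight_diag add0r in pairs.
have sumE : \sum_(1 <= t < h.+1) (W - weight (u t.*2.-1) (u t.*2) + (x t.*2.-1 + x t.*2) - d)
   = h%:R * W - \sum_(1 <= t < h.+1) weight (u t.*2.-1) (u t.*2)
     + \sum_(1 <= t < h.+1) (x t.*2.-1 + x t.*2) - h%:R * d.
  by rewrite !big_split /= !sumrN !sumr_const_nat subn1 /= !mulr_natl -mulNrn.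
rewrite sumE in flips.
have -> : (h.*2.+1)%:R = h%:R * 2 + 1 :> rat by rewrite -addn1 -muln2 natrD natrM.
rewrite -natr1; lra.
Qed.

Lemma sum_shift (n l : nat) (f : nat -> rat) : (forall j, f (j + n)%N = f j) ->
  \sum_(0 <= j < n) f (j + l)%N = \sum_(0 <= j < n) f j.
Proof.
move=> fn; elim: l => [|l IH]; first by apply: eq_bigr => j _; rewrite addn0.
rewrite -IH; apply: (addrI (f l)).
have -> : f l + \sum_(0 <= j < n) f (j + l.+1)%N = \sum_(0 <= j < n.+1) f (j + l)%N.
  rewrite big_nat_recl // add0n; congr (_ + _).
  by apply: eq_bigr => j _; rewrite addSnnS.
by rewrite big_nat_recr //= addnC fn addrC.
Qed.

Lemma sum_windows (k m : nat) (f : nat -> rat) :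
  \sum_(0 <= j < k * m) f j = \sum_(0 <= s < k) \sum_(q < m) f (s + k * q)%N.
Proof.
elim: m => [|m IH].
  by rewrite muln0 big_geq // big1 // => s _; rewrite big_ord0.
rewrite mulnS addnC (big_cat_nat (n := (k * m)%N)) ?leq_addr //= IH.
under [RHS]eq_bigr do rewrite big_ord_recr /=.
rewrite [RHS]big_split /=; congr (_ + _).
by rewrite -{1}[(k * m)%N]add0n big_addn addKn; apply: eq_bigr => s _; rewrite addnC.
Qed.

Lemma nth_rot_mod (T : Type) (x0 : T) (c : seq T) s j : (s < size c)%N -> (j < size c)%N ->
  nth x0 (rot s c) j = nth x0 c ((s + j) %% size c).
Proof.
move=> sc jc; rewrite /rot nth_cat size_drop nth_drop; case: ltnP => h.
  by rewrite modn_small //; lia.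
rewrite nth_take; last by lia.
have -> : (s + j = (j - (size c - s)) + size c)%N by lia.
by rewrite modnDr modn_small //; lia.
Qed.

(** Sum [window_average] over all start positions on the tour. Each path edge then runs through all
    tour edges, which gives [(k - 1)^2] tour weights, plus [h + 1] for the odd edges, minus [h] for
    the even ones. On the other side the starts fall into [k] cuts, each of total at most [B] for
    each flip, and the flips have total multiplicity [2h + 1 = k - 1]. *)
Lemma tour_packing (G : metric_graph) (x0 : vertex G) (c : seq (vertex G)) (k h m : nat) (B : rat) :
  k = h.+1.*2 ->
  (0 < m)%N -> size c = (k * m)%N ->
  (forall s i, (s < k)%N -> (0 < i <= k)%N ->
    \sum_(q < m) closed_weight (window_cycle x0 (rot s c) k (flip_order k i) q) <= B) ->
  (k.-1%:R ^+ 2 + 1) * closed_weight c <= k%:R * k.-1%:R * B.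
Proof.
move=> kE m0 szc leB; set n := size c in szc.
have k0 : (0 < k)%N by lia.
have kn : (k <= n)%N by rewrite szc leq_pmulr.
have n0 : (0 < n)%N by apply: leq_trans kn.
(* The tour is extended periodically, so that a window may start anywhere and run over the end of
   the list. *)
pose v j := nth x0 c (j %% n).
pose w j := weight (v j) (v j.+1).
have wn j : w (j + n)%N = w j by rewrite /w /v -addSn !modnDr.
have cE : closed_weight c = \sum_(0 <= j < n) w j.
  rewrite (closed_weightE x0); last by rewrite -size_eq0 -/n; lia.
  rewrite (path_weight_nth x0) -/n -[in RHS](prednK n0) big_nat_recr //=; congr (_ + _).
    by apply: eq_big_nat => j /andP[_ jn]; rewrite /w /v !modn_small //; lia.
  by rewrite /w /v prednK // modnn modn_small ?prednK // nth_last nth0.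
pose g i j := closed_weight [seq v (j + o)%N | o <- flip_order k i].
have gE s i : (s < k)%N -> (0 < i <= k)%N -> \sum_(q < m) g i (s + k * q)%N =
    \sum_(q < m) closed_weight (window_cycle x0 (rot s c) k (flip_order k i) q).
  move=> sk /andP[_ ik]; apply: eq_bigr => q _; rewrite /g /window_cycle; congr closed_weight.
  apply/eq_in_map => o; rewrite (perm_mem (perm_flip_order ik)) mem_iota add0n => /andP[_ ok].
  have qm : (k * q + o < n)%N.
    rewrite szc; apply: leq_trans (_ : (k * q.+1 <= _)%N); first by rewrite mulnS; lia.
    by rewrite leq_mul2l ltn_ord orbT.
  by rewrite nth_rot_mod -/n //; [rewrite /v addnA|apply: leq_trans sk kn].
have gB i : (0 < i <= k)%N -> \sum_(0 <= j < n) g i j <= k%:R * B.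
  move=> ik; rewrite szc sum_windows mulr_natl -[X in _ *+ X]subn0 -sumr_const_nat.
  by apply: ler_sum_nat => s /andP[_ sk]; rewrite gE //; apply: leB.
have wsum l : \sum_(0 <= j < n) w (j + l)%N = closed_weight c by rewrite cE sum_shift.
have := ler_sum_nat (fun j (_ : (0 <= j < n)%N) => window_average (fun o => v (j + o)%N) kE).
rewrite !big_split /= sumrN -!big_distrr /=.
have wE j l : weight (v (j + l)%N) (v (j + l.+1)%N) = w (j + l)%N by rewrite /w addnS.
have sumw a b (f : nat -> nat) :
    \sum_(0 <= j < n) \sum_(a <= t < b) w (j + f t)%N = (b - a)%:R * closed_weight c.
  rewrite exchange_big_nat /=; under eq_bigr do rewrite wsum.
  by rewrite sumr_const_nat mulr_natl.
have -> : \sum_(0 <= j < n) \sum_(0 <= o < k.-1) weight (v (j + o)%N) (v (j + o.+1)%N)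
    = k.-1%:R * closed_weight c.
  under eq_bigr do under eq_bigr do rewrite wE.
  by rewrite (sumw 0%N k.-1 id) subn0.
have -> : \sum_(0 <= j < n) \sum_(0 <= o < h.+1) weight (v (j + o.*2)%N) (v (j + o.*2.+1)%N)
    = h.+1%:R * closed_weight c.
  under eq_bigr do under eq_bigr do rewrite wE.
  by rewrite (sumw 0%N h.+1 double) subn0.
have -> : \sum_(0 <= j < n) \sum_(1 <= t < h.+1) weight (v (j + t.*2.-1)%N) (v (j + t.*2)%N)
    = h%:R * closed_weight c.
  rewrite -[h in RHS](subn1 h.+1) -(sumw 1%N h.+1 (fun t => t.*2.-1)).
  by apply: eq_bigr => j _; apply: eq_big_nat => -[|t] // _; rewrite -wE.
have -> : \sum_(0 <= j < n) \sum_(1 <= t < h.+1) closed_weight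
    [seq v (j + o)%N | o <- flip_order k t.*2] = \sum_(1 <= t < h.+1) \sum_(0 <= j < n) g t.*2 j.
  by rewrite exchange_big_nat.
have gk : \sum_(0 <= j < n) closed_weight [seq v (j + o)%N | o <- flip_order k k] <= k%:R * B.
  by apply: gB; lia.
have gt : \sum_(1 <= t < h.+1) \sum_(0 <= j < n) g t.*2 j <= h%:R * (k%:R * B).
  rewrite mulr_natl -[X in _ *+ X](subn1 h.+1) -sumr_const_nat.
  by apply: ler_sum_nat => t /andP[t1 th]; apply: gB; lia.
have h1 : h.+1%:R * (\sum_(0 <= j < n) closed_weight [seq v (j + o)%N | o <- flip_order k k])
    <= h.+1%:R * (k%:R * B) by apply: ler_wpM2l gk; apply: ler0n.
have kRE : k.-1%:R = h%:R * 2 + 1 :> rat.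
  by rewrite kE doubleS /= -addn1 -muln2 natrD natrM.
move=> avg.
have : (k.-1%:R ^+ 2 + 1) * closed_weight c = k.-1%:R * (k.-1%:R * closed_weight c)
   + h.+1%:R * closed_weight c - h%:R * closed_weight c by rewrite -natr1; ring.
have : k%:R * k.-1%:R * B = h.+1%:R * (k%:R * B) + h%:R * (k%:R * B).
  by rewrite kRE -natr1; ring.
by lra.
Qed.

Lemma window_packing_perm (T : eqType) (x0 : T) (c : seq T) k m js :
  size c = (k * m)%N -> perm_eq js (iota 0 k) ->
  perm_eq (flatten (window_packing x0 c k m js)) c.
Proof.
move=> szc jsk; rewrite /window_packing.
have idx : perm_eq (flatten [seq [seq (k * q + j)%N | j <- js] | q <- rev (iota 0 m)]) (iota 0 (k * m)).
  apply: (@perm_trans _ (flatten [seq [seq (k * q + j)%N | j <- js] | q <- iota 0 m])).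
    by apply/perm_flatten/perm_map; rewrite perm_rev.
  elim: m {szc} => [|m IH]; first by rewrite muln0.
  rewrite -addn1 iotaD map_cat flatten_cat /= cats0 addn1 mulnSr iotaD perm_cat //.
  by rewrite ?add0n -[X in iota X]addn0 iotaDl; apply: perm_map.
rewrite -map_rev -[X in perm_eq _ X](mkseq_nth x0 c) szc /mkseq.
have -> : flatten [seq window_cycle x0 c k js q | q <- rev (iota 0 m)] =
  [seq nth x0 c i | i <- flatten [seq [seq (k * q + j)%N | j <- js] | q <- rev (iota 0 m)]].
  rewrite map_flatten -map_comp; congr flatten; apply: eq_map => q.
  by rewrite /= -map_comp.
exact: perm_map.
Qed.

Lemma window_packing_feasible (G : metric_graph) (x0 : vertex G) (c : seq (vertex G)) k m js :
    (2 < k)%N -> order_of G = (k * m)%N -> size c = order_of G -> uniq c ->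
    perm_eq js (iota 0 k) ->
  is_kcycle_packing k (window_packing x0 c k m js).
Proof.
move=> k2 nE szc uc jsk.
have fl : perm_eq (flatten (window_packing x0 c k m js)) c.
  by apply: window_packing_perm; rewrite ?szc.
have ufl : uniq (flatten (window_packing x0 c k m js)) by rewrite (perm_uniq fl).
split=> //.
- by rewrite /window_packing size_rev size_map size_iota nE mulKn //; lia.
- apply/allP => d dP; rewrite /is_kcycle k2 /=; apply/andP; split.
    move: dP; rewrite /window_packing mem_rev => /mapP[q _ ->].
    by rewrite /window_cycle size_map (perm_size jsk) size_iota.
  have [i ip <-] := nthP [::] dP.
  move: ufl; elim: (window_packing _ _ _ _ _) i ip {dP} => // e s IH [|i] /=.
    by rewrite cat_uniq => _ /and3P[].
  by rewrite cat_uniq ltnS => /IH {}IH /and3P[_ _ /IH].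
- move=> x; rewrite (perm_mem fl).
  have sub : {subset c <= enum 'I_(order_of G)} by move=> y _; rewrite mem_enum.
  have szE : (size (enum 'I_(order_of G)) <= size c)%N by rewrite size_enum_ord szc.
  by have [_ ->] := uniq_min_size uc sub szE; rewrite mem_enum.
Qed.

(** * Post-processing the output of an arbitrary program *)

Local Open Scope nat_scope.

Fixpoint expr_bound (e : expr) : nat :=
  match e with
  | EVar x => x.+1
  | ENil => 0
  | ECons a b => maxn (expr_bound a) (expr_bound b)
  | EHd a | ETl a => expr_bound a
  end.

Fixpoint cmd_bound (c : cmd) : nat :=
  match c with
  | CAssign x e => maxn x.+1 (expr_bound e)
  | CSeq c d => maxn (cmd_bound c) (cmd_bound d)
  | CIf e c d => maxn (expr_bound e) (maxn (cmd_bound c) (cmd_bound d))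
  | CWhile e c => maxn (expr_bound e) (cmd_bound c)
  end.

Lemma eval_frame m e s r : expr_bound e <= m -> (forall y, y < m -> r y = s y) ->
  eval r e = eval s e.
Proof.
move=> em sr; elim: e em => [x||a IHa b IHb|a IHa|a IHa] //=.
- exact: sr.
- by rewrite geq_max => /andP[/IHa-> /IHb->].
- by move=> /IHa->.
- by move=> /IHa->.
Qed.

(** A program neither reads nor writes variables at or above its bound, so the input can be kept
    there during an unknown program without affecting its run or its time. *)
Lemma exec_frame c s t s' m r : exec c s t s' -> cmd_bound c <= m ->
  (forall y, y < m -> r y = s y) -> exec c r t (fun y => if y < m then s' y else r y).
Proof.
move=> ex; elim: ex r => {c s t s'}.
- move=> x e s r /=; rewrite geq_max => /andP[xm em] sr.
  apply: exec_eq (ExecAssign _ _ _) _ _ => // y; rewrite (eval_frame em sr) /update.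
  by case: eqP => [->|_]; [rewrite xm|case: ifP => // /sr].
- move=> c1 c2 s1 s2 s3 t1 t2 _ IH1 _ IH2 r /=; rewrite geq_max => /andP[m1 m2] sr.
  have sr2 y : y < m -> (if y < m then s2 y else r y) = s2 y by move=> ->.
  by apply: exec_eq (ExecSeq (IH1 r m1 sr) (IH2 _ m2 sr2)) (erefl _) _ => y; case: (y < m).
- move=> e c1 c2 s s' t eN _ IH r /=; rewrite !geq_max => /and3P[em m1 m2] sr.
  by apply: ExecIfTrue (IH r m1 sr); rewrite (eval_frame em sr).
- move=> e c1 c2 s s' t eN _ IH r /=; rewrite !geq_max => /and3P[em m1 m2] sr.
  by apply: ExecIfFalse (IH r m2 sr); rewrite (eval_frame em sr).
- move=> e c s1 s2 s3 t1 t2 eN _ IH1 _ IH2 r /=; rewrite geq_max => /andP[em m1] sr.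
  have mW : cmd_bound (CWhile e c) <= m by rewrite /= geq_max em.
  have eN' : eval r e <> Nil by rewrite (eval_frame em sr).
  have sr2 y : y < m -> (if y < m then s2 y else r y) = s2 y by move=> ->.
  by apply: exec_eq (ExecWhileTrue eN' (IH1 r m1 sr) (IH2 _ mW sr2)) (erefl _) _ => y; case: (y < m).
- move=> e c s eN r /=; rewrite geq_max => /andP[em m1] sr.
  have eN' : eval r e = Nil by rewrite (eval_frame em sr).
  by apply: exec_eq (ExecWhileFalse _ eN') _ _ => // y; case: ifP => // /sr.
Qed.

(** Copying variable 0 to itself acts as the skip command, which [cmd] does not provide. *)
Fixpoint clear_vars (m : nat) : cmd :=
  if m is m'.+1 then CSeq (clear_vars m') (CAssign m'.+1 ENil) else CAssign 0 (EVar 0).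

Lemma exec_clear_vars m s :
  exec (clear_vars m) s (2 + 2 * m) (fun y => if 0 < y <= m then Nil else s y).
Proof.
elim: m => [|m IH] /=.
  apply: exec_eq (ExecAssign _ _ _) _ _ => // y.
  by rewrite /update /=; case: eqP => [->//|]; case: y.
apply: exec_eq (ExecSeq IH (ExecAssign _ _ _)) _ _ => [|y]; first by rewrite /=; lia.
rewrite /update; case: eqP => [->|ny] /=; first by rewrite leqnn.
by have -> : (y <= m.+1) = (y <= m) by lia.
Qed.

(** The input is saved above the variables of [c] and paired with the output of [c]; then everything
    left behind by [c] is cleared, as the program of [f] requires. The initial test returns [Nil] at
    once on [Nil], where nothing is known about [c]. *)
Lemma postprocess (c : cmd) (f : tree -> tree) : polytime f ->
  exists (d : cmd) (F : {poly nat}),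
    computes_in d Nil Nil 4 /\
    forall a b t, a <> Nil -> computes_in c a b t ->
    exists2 t', computes_in d a (f (Cons a b)) t' & t' <= t + F.[tree_size a + tree_size b]%R.
Proof.
move=> /polytime_horner[cf [mf [p [run _]]]].
pose M := (cmd_bound c).+1.
exists (CIf (EVar 0) (CSeq (CAssign M (EVar 0)) (CSeq c (CSeq
  (CAssign 0 (ECons (EVar M) (EVar 0))) (CSeq (clear_vars M) cf)))) (CAssign 0 ENil)).
pose F n := 20 + 2 * M + p.[n + 1]%R.
have [q Fq] : poly_bounded F by rewrite /F; poly_bound.
exists q; split.
  eexists; split; first exact: (ExecIfFalse _ _ (ExecAssign _ _ _)).
  by [].
move=> a b t aN [s [ex s0]].
pose r := update (init_store a) M a.
have rs y : y < M -> r y = init_store a y.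
  by rewrite /r /update => yM; case: eqP => // yE; lia.
have ex1 := exec_frame ex (leqnSn _) rs.
set s1 := (fun y => _) in ex1.
pose s2 := update s1 0 (Cons a b).
pose s3 := (fun y => if 0 < y <= M then Nil else s2 y).
have [||u exf le_u] := run (Cons a b) s3.
- by [].
- move=> y; rewrite /s3 /s2 /s1 /r /update /init_store /update.
  by case: y => // y _; case: ifP => //= yM; rewrite !ifN //; lia.
exists (2 + (2 + (t + (4 + ((2 + 2 * M) + u))))).
  exists (update s3 0 (f (Cons a b))); split=> //.
  apply: ExecIfTrue; first by rewrite /= /init_store /update.
  apply: (ExecSeq (ExecAssign _ _ _)); apply: (ExecSeq ex1); apply: ExecSeq.
    apply: exec_eq (ExecAssign _ _ _) (erefl _) _ => y; reflexivity.
  apply: ExecSeq exf; apply: exec_eq (exec_clear_vars _ _) (erefl _) _ => y.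
  rewrite /s3 /s2; case: ifP => // _; rewrite /update; case: eqP => // _ /=.
  by rewrite /s1 ltnn /r /update eqxx s0.
apply: leq_trans (_ : t + F (tree_size a + tree_size b) <= _); last by rewrite leq_add2l; apply: Fq.
have := @horner_nat_homo p (tree_size (Cons a b)) ((tree_size a + tree_size b)%N + 1)%R.
have -> : tree_size (Cons a b) <= ((tree_size a + tree_size b)%N + 1)%R by rewrite /=; lia.
by move=> /(_ isT)/(leq_trans le_u); rewrite /F; set P := (p.[_])%R; lia.
Qed.

(** * The approximation algorithm *)

Lemma tree_size_enc_cycle (G : metric_graph) (c : seq (vertex G)) :
  tree_size (enc_cycle c) <= size c * (2 * order_of G + 2) + 1.
Proof.
rewrite /enc_cycle; elim: c => //= v c IH.
have -> : tree_size (enc_vertex v) = 2 * v + 1.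
  by rewrite /enc_vertex; elim: (nat_of_ord v) => //= l ->; lia.
by have := ltn_ord v; rewrite mulSn; lia.
Qed.

(** The approximation guarantee speaks of optimal solutions, so it yields something only once one
    exists: here a maximum over the finitely many duplicate-free tuples. *)
Lemma tsp_optimum (G : metric_graph) : 3 <= order_of G ->
  exists y : seq (vertex G), @optimal metric_TSP G y.
Proof.
move=> n3.
have szt : size (enum 'I_(order_of G)) == order_of G by rewrite size_enum_ord.
pose F (t : (order_of G).-tuple (vertex G)) := cycle_weight t.
have u0 : uniq (Tuple szt) by rewrite enum_uniq.
case: (arg_maxP (P := fun t : (order_of G).-tuple (vertex G) => uniq t) F u0) => t ut tmax.
exists t; split; first by rewrite /= /is_kcycle n3 size_tuple eqxx.
move=> z /= /and3P[_ szz uz]; exact: (tmax (Tuple szz) uz).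
Qed.

Local Open Scope ring_scope.

(** [X] is the optimal packing weight, [Z] the optimal tour weight, [Y] the weight of the tour found
    and [B] that of the packing returned. The last factor of the ratio equals
    [((k - 1)^2 + 1) / (k (k - 1))]. *)
Lemma approximation_chain (R : realType) (k : nat) (alpha : R) (X Y Z B : rat) :
    (4 <= k)%N -> 0 < alpha ->
    (1 - 1 / 2 / k%:R) * X <= Z -> alpha * ratr Z <= ratr Y ->
    (k.-1%:R ^+ 2 + 1) * Y <= k%:R * k.-1%:R * B ->
  alpha * (1 - 1 / 2 / k%:R) * (1 - 1 / k%:R + 1 / (k%:R * (k%:R - 1))) * ratr X <= ratr B.
Proof.
move=> k4 alpha_gt0 le_Z le_Y le_b.
have {}le_Z : (1 - 1 / 2 / k%:R) * ratr X <= ratr Z :> R.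
  by move: le_Z; rewrite -(ler_rat R) !(rmorphM, rmorphB, fmorphV, rmorph1, rmorph_nat).
have {}le_b : (k.-1%:R ^+ 2 + 1) * ratr Y <= k%:R * k.-1%:R * ratr B :> R.
  by move: le_b; rewrite -(ler_rat R) !(rmorphM, rmorphD, rmorphXn, rmorph1, rmorph_nat).
have kR : 4 <= k%:R :> R by rewrite ler_nat.
have k1R : k.-1%:R = k%:R - 1 :> R by rewrite -subn1 natrB //; lia.
have -> : 1 - 1 / k%:R + 1 / (k%:R * (k%:R - 1)) =
    (k.-1%:R ^+ 2 + 1) / (k%:R * k.-1%:R) :> R.
  by rewrite k1R; field; apply/andP; split; apply/eqP; lra.
have den_gt0 : 0 < k%:R * k.-1%:R :> R by rewrite k1R; nra.
set beta := (_ ^+ 2 + 1) / _; have beta_ge0 : 0 <= beta.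
  by apply: divr_ge0; [rewrite addr_ge0 ?sqr_ge0 ?ler01|apply: ltW].
apply: (@le_trans _ _ (beta * ratr Y)); last first.
  by rewrite mulrAC ler_pdivrMr // [ratr B * _]mulrC.
set gamma := 1 - 1 / 2 / k%:R in le_Z *.
have -> : alpha * gamma * beta * ratr X = beta * (alpha * (gamma * ratr X)) by ring.
apply: ler_wpM2l beta_ge0 _ _ _; apply: le_trans le_Y.
exact: ler_wpM2l (ltW alpha_gt0) _ _ le_Z.
Qed.

Unset Implicit Arguments.

Theorem mainTheorem2 (R : realType) (k : nat) (alpha : R)
    (k_ge4 : (4 <= k)%N) (k_even : ~~ odd k)
    (alpha_gt0 : 0 < alpha) (alpha_le1 : alpha <= 1)
    (tsp : polytime_approximable metric_TSP alpha) :
  polytime_approximable (metric_kCP k)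
    (alpha * (1 - (1 / 2) / k%:R)
       * (1 - 1 / k%:R + 1 / (k%:R * (k%:R - 1)))).
Proof.
have [h kE] : exists h, k = h.+1.*2 by exists k./2.-1; lia.
have [c [p tspP]] := tsp.
pose cand (si : nat * nat) := tcand k si.1 (flip_order k si.2).
(* All offsets [s] and all flip points [i] are tried; the averaging argument uses the even [i], and
   further candidates can only raise the maximum. *)
pose idx := [seq (s, i) | s <- iota 0 k, i <- iota 1 k].
have idxP s i : ((s, i) \in idx) = (s < k)%N && (0 < i <= k)%N.
  apply/allpairsP/idP => [[[s' i'] [/= + + [-> ->]]]|si_lt].
    by rewrite !mem_iota; lia.
  by exists (s, i); split; rewrite //= mem_iota; lia.
have post_poly : polytime (fun z => tree_tl (tbest cand idx z)).
  by apply/polytime_tl/polytime_best => si; apply: polytime_cand.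
have [d [F [d_nil dP]]] := postprocess c post_poly.
(* The three terms are the time on the empty graph, the time of the TSP program, and the time for
   the rest, where the code of a tour has size at most [N * (2 * N + 2) + 1] because the order of
   the graph is below [N]. *)
pose T N := (4 + p.[N]%R + F.[N + (N * (2 * N + 2) + 1)]%R)%N.
have [q Tq] : poly_bounded T by rewrite /T; poly_bound.
exists d, q => G /= /dvdnP[m]; rewrite mulnC => nE.
(* The empty graph is a valid packing instance but has no tour. Its code [Nil] is also the code of
   the empty packing; any other instance has at least [k] vertices. *)
have [m0|m_gt0] := posnP m.
  have n0 : order_of G = 0%N by rewrite nE m0 muln0.
  have encN : enc_graph G = Nil.
    by rewrite /enc_graph enc_seqE; have /size0nil -> := etrans (size_enum_ord (order_of G)) n0.
  exists [::], 4%N; split.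
  - by rewrite encN.
  - by apply: leq_trans (Tq _); rewrite /T; lia.
  - by split=> //; [rewrite n0 div0n|move=> v; have := ltn_ord v; lia].
  - move=> opt [[sz _ _ _] _]; have /size0nil -> : size opt = 0%N by rewrite sz n0 div0n.
    by rewrite /packing_weight big_nil rmorph0 mulr0.
have n_gt0 : (0 < order_of G)%N by rewrite nE; lia.
have n_ge3 : (3 <= order_of G)%N by rewrite nE; nia.
pose x0 : vertex G := Ordinal n_gt0.
have [y [t [yt le_t /and3P[_ /eqP szy uy] yapx]]] := tspP G n_ge3.
have encN : enc_graph G <> Nil.
  move=> encN; have := congr1 (fun t => size (elems t)) encN.
  by rewrite /enc_graph enc_seqE tlistK size_map size_enum_ord /=; lia.
have [t' yt' le_t'] := dP _ _ _ encN yt.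
have k_gt0 : (0 < k)%N by lia.
have szyk : size y = (k * m)%N by rewrite szy.
have candP si : si \in idx -> let r := cand si (Cons (enc_graph G) (enc_cycle y)) in
    [/\ is_tratio (tree_hd r),
      tratio (tree_hd r) = \sum_(j < m) closed_weight
        (window_cycle x0 (rot si.1 y) k (flip_order k si.2) j)
    & tree_tl r = enc_packing (window_packing x0 (rot si.1 y) k m (flip_order k si.2))].
  case: si => s i; rewrite idxP => /andP[sk ik]; apply: tcandE => //.
    by apply: leq_trans (ltnW sk) _; rewrite szyk leq_pmulr.
  have /andP[_ {}ik] := ik.
  by apply/allP => j; rewrite (perm_mem (perm_flip_order ik)) mem_iota => /andP[].
have cw_ge0 (w : seq (vertex G)) : 0 <= closed_weight w.
  by apply: sumr_ge0 => e _; apply: weight_ge0.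
have [||[s i] si_idx [bestE best_max]] :=
    @tbestP _ cand idx (Cons (enc_graph G) (enc_cycle y)).
- have : (0%N, 1%N) \in idx by rewrite idxP; lia.
  by case: (idx).
- move=> si /candP[r0 -> _]; split=> //.
  by apply: sumr_ge0.
have [r0 valE encE] := candP _ si_idx.
have /andP[sk /andP[_ ik]] : (s < k)%N && (0 < i <= k)%N by rewrite -idxP.
have feas : is_kcycle_packing k (window_packing x0 (rot s y) k m (flip_order k i)).
  apply: window_packing_feasible; rewrite ?size_rot ?rot_uniq //; first by lia.
  exact: perm_flip_order.
exists (window_packing x0 (rot s y) k m (flip_order k i)), t'; split.
- have outE : tree_tl (tbest cand idx (Cons (enc_graph G) (enc_cycle y)))
      = enc_packing (window_packing x0 (rot s y) k m (flip_order k i)) by rewrite bestE.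
  by move: yt'; rewrite outE.
- apply: leq_trans (Tq _); rewrite /T; apply: leq_trans le_t' _.
  have nN : (order_of G < tree_size (enc_graph G))%N.
    have := size_elems (enc_graph G).
    by rewrite {1}/enc_graph enc_seqE tlistK size_map size_enum_ord.
  have szb : (tree_size (enc_cycle y) <= tree_size (enc_graph G) *
      (2 * tree_size (enc_graph G) + 2) + 1)%N.
    apply: leq_trans (tree_size_enc_cycle y) _; rewrite szy leq_add2r.
    by apply: leq_mul; lia.
  apply: leq_add; first by apply: leq_trans le_t _; apply: leq_addl.
  by apply: horner_nat_homo; apply: leq_add szb.
- exact: feas.
move=> opt [[opt_sz /allP opt_cyc opt_uniq opt_all] _].
set B := packing_weight (window_packing x0 (rot s y) k m (flip_order k i)).
have BE : B = \sum_(j < m) closed_weight (window_cycle x0 (rot s y) k (flip_order k i) j).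
  have [_ /allP cyc _ _] := feas.
  transitivity (\sum_(e <- window_packing x0 (rot s y) k m (flip_order k i)) closed_weight e).
    rewrite /B /packing_weight; apply: eq_big_seq => e /cyc/and3P[_ _ ue].
    exact: cycle_weightE.
  by rewrite /window_packing big_rev big_map -{1}(subn0 m) big_mkord.
(* The returned packing is the heaviest candidate, so its own weight can serve as the bound in
   [tour_packing]. *)
have le_B : (k.-1%:R ^+ 2 + 1) * cycle_weight y <= k%:R * k.-1%:R * B.
  rewrite cycle_weightE //; apply: (tour_packing (x0 := x0) kE m_gt0 szyk) => s' i' s'k i'k.
  have si' : (s', i') \in idx by rewrite idxP s'k.
  by have [_ <- _] := candP _ si'; rewrite BE -valE; apply: best_max.
have [yo yo_opt] := tsp_optimum n_ge3.
have opt_le : (1 - 1 / 2 / k%:R) * packing_weight opt <= cycle_weight yo.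
  have optN0 : opt != [::] by rewrite -size_eq0 opt_sz nE mulKn //; lia.
  have opt_szk : all (fun c => size c == k) opt by apply/allP => e /opt_cyc/and3P[].
  have [H HP le_H] := packing_tour k_gt0 optN0 opt_szk.
  have uH : uniq H by rewrite (perm_uniq HP).
  have szH : size H = order_of G.
    rewrite (perm_size HP); apply: etrans (size_enum_ord _).
    apply/perm_size/uniq_perm; [exact: opt_uniq|exact: enum_uniq|].
    by move=> v; rewrite mem_enum opt_all.
  have -> : packing_weight opt = \sum_(e <- opt) closed_weight e.
    rewrite /packing_weight; apply: eq_big_seq => e /opt_cyc/and3P[_ _ ue].
    exact: cycle_weightE.
  apply: le_trans le_H _; rewrite -cycle_weightE //; apply: yo_opt.2.
  by rewrite /= /is_kcycle n_ge3 szH eqxx.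
exact: approximation_chain k_ge4 alpha_gt0 opt_le (yapx yo yo_opt) le_B.
Qed.
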